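(* Let $H=(V,E,p,D)$ be a frame with $|V|=K$ classes, let $R$ be the Markov matrix of the frame, and suppose that the eigenvalues $\lambda_1,\dots,\lambda_K$ of $R$, listed in decreasing order of absolute value, satisfy $|\lambda_K|>0$. Then there exists $\kappa\in\mathbb{N}$ such that, replacing $D$ by $\kappa D$, for a random regular frame graph $G\sim\mathcal{G}(n,H_\kappa)$ with $H_\kappa=(V,E,p,\kappa D)$ and Markov matrix $P=P(G)$, with probability tending to $1$ as $n\to\infty$ the vertex classes of $G$ are recoverable by spectral clustering of the leading $K$ eigenvectors of $P$.
   Context: A frame $H=(V,E,p,D)$ is a weighted directed graph with finite vertex set $V$, directed edge set $E\subseteq V\times V$ (self loops allowed), vertex weights $p\in\mathbb{R}^{V}$ (positive, $\sum_{i\in V}p_i=1$), and a matrix of degrees $D\in\mathbb{N}^{V\times V}$ supported on $E$ (with $D_{ij}=0$ when $(i,j)\notin E$), satisfying the balance condition $p_iD_{ij}=p_jD_{ji}$ for all $i,j\in V$ with $(i,j)\in E$ or $(j,i)\in E$ (so each edge's reverse is also in $E$). It is assumed that $n_i=np_i$ is an integer for all $i\in V$. The random regular frame graph distribution $\mathcal{G}(n,H)$ is the uniform distribution on simple graphs on $n$ vertices, with $n_i$ vertices in class $i$, such that every vertex of class $i$ has exactly $D_{ij}$ neighbors in class $j$, for all $i,j\in V$; $n\to\infty$ along values for which such graphs exist. The Markov matrix of a simple graph $G$ is $P=D_G^{-1}A$, where $A$ is the adjacency matrix and $D_G$ the diagonal matrix of vertex degrees. The Markov matrix of the frame is $R_{ij}=D_{ij}/\sum_{l}D_{il}$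 (row sums of $D$ are positive); it is unchanged under $D\to\kappa D$, and its eigenvalues are real. Any eigenpair $(\lambda,x)$ of $R$ lifts to an eigenpair $(\lambda,\tilde x)$ of $P$, where $\tilde x$ equals $x_i$ on all vertices of class $i$. Spectral clustering: ''the leading $K$ eigenvectors of $P$'' are $K$ linearly independent eigenvectors $x^1,\dots,x^K$ for the $K$ eigenvalues of $P$ of largest absolute value (with multiplicity). To each vertex $v$ of $G$ associate $y^v\in\mathbb{R}^K$ with $y^v_j=x^j_v$, and group vertices $u,v$ together when $y^u=y^v$. The classes are recoverable by spectral clustering of these eigenvectors if the eigenvectors are piecewise constant on classes and, for all vertices $u,v$, $y^u=y^v$ if and only if $u$ and $v$ belong to the same class. *)

(* Defs.v *)
From HB Require Import structures.
From mathcomp Require Import all_boot all_order all_algebra.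
From mathcomp Require Import all_classical all_reals all_analysis.

Set Implicit Arguments.
Unset Strict Implicit.
Unset Printing Implicit Defensive.

Import Order.TTheory GRing.Theory Num.Theory.
Import numFieldNormedType.Exports.

Local Open Scope ring_scope.

(* The class set V is 'I_K.  The degree matrix may vanish on an edge. *)
Record frame (R : realType) (K : nat) := Frame {
  edge : rel 'I_K;
  weight : 'I_K -> R;
  degree : 'M[nat]_K;
  weight_gt0 : forall i, 0 < weight i;
  weight_sum1 : \sum_i weight i = 1;
  edge_sym : forall i j, edge i j -> edge j i;
  degree_supp : forall i j, ~~ edge i j -> degree i j = 0%N;
  balance : forall i j, edge i j || edge j i ->
    weight i * (degree i j)%:R = weight j * (degree j i)%:R
}.

Definition scale_degree (K : nat) (kappa : nat) (D : 'M[nat]_K) : 'M[nat]_K :=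
  \matrix_(i, j) (kappa * D i j)%N.

Lemma scale_degree_supp (R : realType) (K : nat) (H : frame R K) (kappa : nat)
    (i j : 'I_K) :
  ~~ edge H i j -> scale_degree kappa (degree H) i j = 0%N.
Proof. by move=> /degree_supp Dij; rewrite mxE Dij muln0. Qed.

Lemma scale_degree_balance (R : realType) (K : nat) (H : frame R K)
    (kappa : nat) (i j : 'I_K) :
  edge H i j || edge H j i ->
  weight H i * (scale_degree kappa (degree H) i j)%:R =
  weight H j * (scale_degree kappa (degree H) j i)%:R.
Proof. by move=> /balance Dij; rewrite !mxE !natrM !(mulrCA _ kappa%:R) Dij. Qed.

Definition scale_frame (R : realType) (K : nat) (H : frame R K) (kappa : nat) :
    frame R K :=
  Frame (weight_gt0 H) (weight_sum1 H) (@edge_sym _ _ H)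
    (@scale_degree_supp R K H kappa) (@scale_degree_balance R K H kappa).

Definition frame_markov (R : realType) (K : nat) (H : frame R K) : 'M[R]_K :=
  \matrix_(i, j) ((degree H i j)%:R / (\sum_l degree H i l)%N%:R).

(* A graph on 'I_n is given by its boolean adjacency matrix. *)
Definition simple_graph (n : nat) (G : 'M[bool]_n) : bool :=
  (G^T == G) && [forall v, ~~ G v v].

Definition adjacency (R : realType) (n : nat) (G : 'M[bool]_n) : 'M[R]_n :=
  \matrix_(u, v) (G u v)%:R.

Definition degree_mx (R : realType) (n : nat) (G : 'M[bool]_n) : 'M[R]_n :=
  diag_mx (\row_v #|[set w | G v w]|%:R).

(* [invmx] is the true inverse only when no vertex is isolated. *)
Definition graph_markov (R : realType) (n : nat) (G : 'M[bool]_n) : 'M[R]_n :=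
  invmx (degree_mx R G) *m adjacency R G.

(* Since the left-hand side is a natural number, this includes the requirement
   that every n * p_i be an integer. *)
Definition class_sizes (R : realType) (K : nat) (H : frame R K) (n : nat)
    (c : {ffun 'I_n -> 'I_K}) : Prop :=
  forall i, #|[set v | c v == i]|%:R = n%:R * weight H i.

(* The support of G(n, H), the class of each vertex being prescribed by c. *)
Definition frame_graphs (R : realType) (K : nat) (H : frame R K) (n : nat)
    (c : {ffun 'I_n -> 'I_K}) : {set 'M[bool]_n} :=
  [set G | simple_graph G &
    [forall v, forall j, #|[set w | G v w & c w == j]| == degree H (c v) j]].

Definition uniform_prob_in (R : realType) (T : finType) (S : {set T})
    (E : T -> Prop) : R :=
  #|[set x in S | `[< E x >]]|%:R / #|S|%:R.

(* All the eigenvalues of A, with algebraic multiplicity, by decreasing absolute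
   value; such a list exists exactly when all complex eigenvalues are real. *)
Definition eigenvalue_list (R : realType) (n : nat) (A : 'M[R]_n)
    (s : seq R) : Prop :=
  char_poly A = \prod_(z <- s) ('X - z%:P) /\
  sorted (fun a b : R => `|b| <= `|a|) s.

(* The columns of X are K leading eigenvectors of A.  In case of ties in absolute
   value, any choice of the K eigenvalues is allowed. *)
Definition leading_eigenvectors (R : realType) (n K : nat) (A : 'M[R]_n)
    (X : 'M[R]_(n, K)) : Prop :=
  exists s : seq R,
    [/\ eigenvalue_list A s, (K <= size s)%N,
        forall j : 'I_K, A *m col j X = s`_j *: col j X &
        row_free X^T].

(* The point y^v of the clustering is [row v X]. *)
Definition clustering_recovers (R : realType) (n K : nat)
    (c : {ffun 'I_n -> 'I_K}) (X : 'M[R]_(n, K)) : Prop :=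
  (forall (j : 'I_K) (u v : 'I_n), c u = c v -> X u j = X v j) /\
  (forall u v : 'I_n, row u X = row v X <-> c u = c v).

(* Leading eigenvectors are not unique: they must exist, and every choice of
   them must recover the classes. *)
Definition spectrally_recoverable (R : realType) (n K : nat)
    (c : {ffun 'I_n -> 'I_K}) (P : 'M[R]_n) : Prop :=
  (exists X : 'M[R]_(n, K), leading_eigenvectors P X) /\
  (forall X : 'M[R]_(n, K), leading_eigenvectors P X -> clustering_recovers c X).

(* Main.v *)
Require Import Defs.
From mathcomp Require Import all_boot all_order all_algebra perm.
From mathcomp Require Import all_classical all_reals all_analysis.
From mathcomp Require Import ring lra complex.

(** Every eigenvector of the frame lifts to an eigenvector of the Markov matrix
    P of G that is constant on the classes, so the theorem says that the other
    eigenvalues of P are smaller in absolute value than lambda_K.  Write A for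
    the adjacency matrix and Q_uv for the density of edges between the classes
    of u and v.  If P x = z x and y is x minus its class averages, then y is
    orthogonal to all functions of the class, hence
    z (sum of deg(u) y_u^2) = y^T A y = y^T (A - Q) y.  All degrees are at
    least kappa, so y = 0 as soon as |z| >= |lambda_K| and
    |y^T (A - Q) y| <= |lambda_K| kappa / 2 |y|^2
    ([eigenvector_class_function], [markov_recoverable]).  It remains to prove
    this last bound for all y with high probability ([spectral_gap_whp]).
    Any bound o(kappa) would do, and kappa may be as large as one likes; this
    is what keeps the argument elementary.

    The bound follows the method of Kahn and Szemeredi, carried out directly in
    the uniform model with switchings: two edges ab and uv, with a, u in one
    class and b, v in one class, are replaced by av and ub.  By a net argument
    it suffices to treat one vector y with |y|^2 <= n, at the price of a union
    bound over 2^(18 n) vectors ([net_bound], [card_net]).  Let tau be a small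
    multiple of kappa.

    - Light pairs, |y_u y_v| <= tau.  The degree conditions fix all the averages
      over pairs of edges, so the average change of a weighted edge count under
      a switch is proportional to its deviation from a constant
      ([sum_switch_gain]).  Since switching is reversible, the method of
      exchangeable pairs turns this into a differential inequality for the
      exponential moments ([exp_moment_derive_le]), and a deviation of order
      kappa n has probability at most 2 e^(-20 n) ([light_tail_count]), which
      beats the size of the net.

    - Heavy pairs, |y_u y_v| > tau.  If one coordinate is much smaller than the
      other, the bounded degrees suffice.  Otherwise u and v both lie in a set
      of O(n / kappa) vertices.  Switching also shows that a given set F of
      edges lies in G with probability at most (C / n)^|F|
      ([card_graphs_containing]); so with high probability no set T of this size
      spans more than alpha |T| edges, alpha being a small multiple of kappa
      ([card_dense_graphs]), and a graph with this property has a small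
      quadratic form ([sparse_form_le]).

    Finally P is self-adjoint for the inner product weighted by the degrees,
    hence diagonalizable over the reals, which provides leading eigenvectors
    ([selfadjoint_leading_eigenvectors]). *)

Set Implicit Arguments.
Unset Strict Implicit.
Unset Printing Implicit Defensive.

Import Order.TTheory GRing.Theory Num.Theory.
Import numFieldNormedType.Exports.

Local Open Scope ring_scope.

(** * Switching two edges of a graph *)

Section SwitchedGraph.
Variables (n : nat).
Implicit Types (G : 'M[bool]_n) (a b u v x y : 'I_n).

Definition joins a b x y : bool :=
  (x == a) && (y == b) || (x == b) && (y == a).

(** In a simple graph, [~~ G a v] also holds when a = v: the last two
    conditions keep the switch from creating a loop. *)
Definition switchable G a b u v : bool :=
  [&& G a b, G u v, ~~ G a v, ~~ G u b, a != v & u != b].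

Definition switch G a b u v : 'M[bool]_n :=
  \matrix_(x, y) ((G x y && ~~ joins a b x y && ~~ joins u v x y)
                  || joins a v x y || joins u b x y).

Lemma joinsC a b x y : joins a b y x = joins a b x y.
Proof. by rewrite /joins orbC andbC; congr (_ || _); rewrite andbC. Qed.

Lemma joinsxx a b x : a != b -> joins a b x x = false.
Proof.
move=> ab; rewrite /joins; apply/negP => /orP[] /andP[/eqP-> /eqP e];
  by move: ab; rewrite e eqxx.
Qed.

Lemma joins_graph G a b x y : simple_graph G -> joins a b x y -> G x y = G a b.
Proof.
move=> /andP[/eqP sG _] /orP[] /andP[/eqP-> /eqP->] //.
by rewrite -{1}sG mxE.
Qed.

Lemma simple_graphC G x y : simple_graph G -> G x y = G y x.
Proof. by move=> /andP[/eqP sG _]; rewrite -{1}sG mxE. Qed.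

Lemma simple_graphxx G x : simple_graph G -> G x x = false.
Proof. by move=> /andP[_ /forallP/(_ x)/negbTE]. Qed.

Lemma joinsE (R : pzRingType) a b x y : a != b ->
  (joins a b x y)%:R = (x == a)%:R * (y == b)%:R + (x == b)%:R * (y == a)%:R :> R.
Proof.
move=> ab; rewrite /joins.
case: (eqVneq x a) => [->|xa] /=; last by rewrite mul0r add0r -natrM mulnb.
by rewrite (negbTE ab) /= mul0r addr0 orbF mul1r.
Qed.

Lemma switchable_neq G a b u v : simple_graph G -> switchable G a b u v ->
  [/\ a != b, u != v, a != u & b != v].
Proof.
move=> sG /and5P[ab uv nav nub _]; split; apply: contraTneq isT => e.
- by rewrite e simple_graphxx in ab.
- by rewrite e simple_graphxx in uv.
- by rewrite e uv in nav.
- by rewrite e uv in nub.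
Qed.

(** The signed sum makes every linear statistic of the switched graph, such as
    a degree or a weighted edge count, a matter of computation. *)
Lemma switch_edge (R : pzRingType) G a b u v x y :
  simple_graph G -> switchable G a b u v ->
  (switch G a b u v x y)%:R =
  (G x y)%:R - (joins a b x y)%:R - (joins u v x y)%:R
  + (joins a v x y)%:R + (joins u b x y)%:R :> R.
Proof.
move=> sG sw; have [ab uv au bv] := switchable_neq sG sw.
case/and5P: sw => Gab Guv nav nub /andP[av ub]; rewrite mxE.
have jg := joins_graph sG.
have excl p q r s (pq : p != q) : (p != r) || (q != s) -> (p != s) || (q != r) ->
    joins p q x y -> joins r s x y = false.
  move=> h1 h2 /orP[] /andP[/eqP-> /eqP->]; rewrite /joins -!negb_and in h1 h2 *.
    by rewrite (negbTE h1) (negbTE h2).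
  by rewrite andbC (negbTE h2) andbC (negbTE h1).
have [ua vb] : u != a /\ v != b by rewrite eq_sym au eq_sym.
case jab: (joins a b x y).
  rewrite (jg _ _ _ _ jab) Gab (excl a b u v) ?(excl a b a v) ?(excl a b u b) ?au ?av ?ab ?bv ?orbT //=.
  by rewrite subrr subr0 !addr0.
case juv: (joins u v x y).
  rewrite (jg _ _ _ _ juv) Guv (excl u v a v) ?(excl u v u b) ?uv ?ua ?ub ?vb ?orbT //=.
  by rewrite subr0 subrr !addr0.
case jav: (joins a v x y).
  rewrite (jg _ _ _ _ jav) (negbTE nav) (excl a v u b) ?av ?au ?ab //=.
  by rewrite !subr0 add0r addr0.
case jub: (joins u b x y).
  by rewrite (jg _ _ _ _ jub) (negbTE nub) /= !subr0 !add0r.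
by rewrite !andbT !orbF !subr0 !addr0.
Qed.

Lemma switch_simple G a b u v :
  simple_graph G -> switchable G a b u v -> simple_graph (switch G a b u v).
Proof.
move=> sG sw; have [ab uv au bv] := switchable_neq sG sw.
case/and5P: (sw) => Gab Guv nav nub /andP[av ub].
apply/andP; split.
  by apply/eqP/matrixP => x y; rewrite !mxE !(joinsC _ _ x) (simple_graphC y x).
apply/forallP => x; rewrite mxE simple_graphxx //=.
by rewrite !joinsxx.
Qed.

Lemma switchable_switch G a b u v : simple_graph G ->
  switchable G a b u v -> switchable (switch G a b u v) a v u b.
Proof.
move=> sG sw; have [ab uv au bv] := switchable_neq sG sw.
case/and5P: (sw) => Gab Guv nav nub /andP[av ub].
by rewrite /switchable !mxE /joins !eqxx (negbTE ab) (negbTE uv) (negbTE av)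
  (negbTE ub) (negbTE au) (negbTE bv) ?(eq_sym b) ?(eq_sym v) ?(eq_sym u a)
  (negbTE ab) (negbTE uv) (negbTE av)
  (negbTE ub) (negbTE au) (negbTE bv) ?orbT ?andbF.
Qed.

(** Reversibility: it is what allows sums over all graphs and all their switches
    to be symmetrized. *)
Lemma switchK G a b u v : simple_graph G ->
  switchable G a b u v -> switch (switch G a b u v) a v u b = G.
Proof.
move=> sG sw; apply/matrixP => x y.
have sw' := switchable_switch sG sw.
have := switch_edge int x y (switch_simple sG sw) sw'.
rewrite (switch_edge int x y sG sw) => e.
have {}e : (switch (switch G a b u v) a v u b x y)%:R = (G x y)%:R :> int.
  by rewrite e; ring.
by case: (switch _ _ _ _ _ x y) (G x y) e => [] [].
Qed.

End SwitchedGraph.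

(** * Averages over the switches of a frame graph *)

Section FrameGraphs.
Variables (R : realType) (K : nat) (H : frame R K).
Variables (n : nat) (c : {ffun 'I_n -> 'I_K}).
Hypothesis cs : class_sizes H c.
Implicit Types (G : 'M[bool]_n) (a b u v x y : 'I_n) (i j : 'I_K).

Notation Om := (frame_graphs H c).

Lemma frame_graph_simple G : G \in Om -> simple_graph G.
Proof. by rewrite inE => /andP[]. Qed.

Lemma frame_graph_degree G v j : G \in Om ->
  \sum_w (c w == j)%:R * (G v w)%:R = (degree H (c v) j)%:R :> R.
Proof.
rewrite inE => /andP[_ /forallP/(_ v)/forallP/(_ j)/eqP <-].
rewrite -sum1_card natr_sum [RHS]big_mkcond /=; apply: eq_bigr => w _.
by rewrite inE; case: (G v w); case: (c w == j) => /=; rewrite ?mulr0 ?mulr1.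
Qed.

Lemma frame_graphP G :
  reflect (simple_graph G /\ forall v j,
     \sum_w (c w == j)%:R * (G v w)%:R = (degree H (c v) j)%:R :> R)
    (G \in Om).
Proof.
apply: (iffP idP) => [GO|[sG dG]].
  by split; [exact: frame_graph_simple | move=> v j; exact: frame_graph_degree].
rewrite inE sG /=; apply/forallP => v; apply/forallP => j.
rewrite -(eqr_nat R) -dG; apply/eqP; symmetry.
rewrite -sum1_card natr_sum [RHS]big_mkcond /=; apply: eq_bigr => w _.
by rewrite inE; case: (G v w); case: (c w == j) => /=; rewrite ?mulr0 ?mulr1.
Qed.

(** Each of the four vertices exchanges a neighbour for another one of the same
    class. *)
Lemma switch_frame_graph G a b u v : G \in Om -> c a = c u -> c b = c v ->
  switchable G a b u v -> switch G a b u v \in Om.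
Proof.
move=> GO au bv sw; have sG := frame_graph_simple GO.
apply/frame_graphP; split; first exact: switch_simple.
move=> x j; rewrite -(frame_graph_degree x j GO).
have [ab uv _ _] := switchable_neq sG sw.
have [av ub] : a != v /\ u != b by case/and5P: sw => _ _ _ _ /andP[].
have pick y (f : bool) : \sum_w (c w == j)%:R * (f%:R * (w == y)%:R) =
    (c y == j)%:R * f%:R :> R.
  rewrite (bigD1 y) //= eqxx mulr1 big1 ?addr0 // => w /negbTE ->.
  by rewrite !mulr0.
under eq_bigr => w _.
  rewrite switch_edge // !joinsE // !(mulrDr, mulrN, opprD).
  over.
by rewrite !(sumrN, big_split) /= !pick au bv; ring.
Qed.

(** Number of ordered pairs of adjacent vertices, the first in class i and the
    second in class j; an edge inside a class counts twice. *)
Definition edge_count i j : R := n%:R * weight H i * (degree H i j)%:R.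

(** The chance that two vertices of classes i and j are joined when their
    [degree H i j] and [degree H j i] half-edges are matched at random among the
    half-edges of the same kind. *)
Definition edge_density i j : R :=
  (degree H i j)%:R * (degree H j i)%:R / edge_count i j.

Lemma balanceE i j :
  weight H i * (degree H i j)%:R = weight H j * (degree H j i)%:R.
Proof.
case e : (edge H i j || edge H j i); first exact: balance.
by move/negbT: e; rewrite negb_or => /andP[/degree_supp -> /degree_supp ->]; rewrite !mulr0.
Qed.

Lemma edge_countC i j : edge_count i j = edge_count j i.
Proof. by rewrite /edge_count -!mulrA balanceE. Qed.

Lemma edge_densityC i j : edge_density i j = edge_density j i.
Proof. by rewrite /edge_density edge_countC mulrC [X in X / _]mulrC mulrC. Qed.

Lemma class_sizeE i : \sum_v (c v == i)%:R = n%:R * weight H i.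
Proof.
rewrite -cs -sum1_card natr_sum [RHS]big_mkcond /=; apply: eq_bigr => v _.
by rewrite inE; case: ifP.
Qed.

Lemma sum_edges_of_type G i j : G \in Om ->
  \sum_u \sum_v (c u == i)%:R * (c v == j)%:R * (G u v)%:R = edge_count i j.
Proof.
move=> GO; rewrite /edge_count -class_sizeE mulr_suml; apply: eq_bigr => u _.
under eq_bigr do rewrite -mulrA; rewrite -mulr_sumr frame_graph_degree //.
by case: eqP => [->//|]; rewrite !mul0r.
Qed.

Lemma vertices_gt0 a : 0 < n%:R :> R.
Proof. by rewrite ltr0n; case: n a => // -[]. Qed.

Lemma edge_count_neq0 G a b : G \in Om -> G a b -> edge_count (c a) (c b) != 0.
Proof.
move=> GO Gab; apply: lt0r_neq0; rewrite /edge_count !mulr_gt0 ?vertices_gt0 ?weight_gt0 //.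
rewrite -(frame_graph_degree a (c b) GO).
rewrite (bigD1 b) //= eqxx Gab mulr1 ltr_pwDl ?ltr01 // sumr_ge0 //.
Qed.

Lemma edge_count_ge0 i j : 0 <= edge_count i j.
Proof. by rewrite !mulr_ge0 // ltW ?weight_gt0. Qed.

Lemma edge_density_ge0 i j : 0 <= edge_density i j.
Proof. by rewrite divr_ge0 ?edge_count_ge0 // mulr_ge0. Qed.

(** The denominator makes uv uniformly distributed among the edges that join the
    same classes as ab. *)
Definition switch_weight G a b u v : R :=
  (c a == c u)%:R * (c b == c v)%:R * (G a b)%:R * (G u v)%:R
  / edge_count (c a) (c b).

Lemma switch_weight_ge0 G a b u v : 0 <= switch_weight G a b u v.
Proof. by rewrite divr_ge0 ?edge_count_ge0 // !mulr_ge0. Qed.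

Lemma switch_weightC G a b u v : switch_weight G a b u v = switch_weight G u v a b.
Proof.
rewrite /switch_weight [c u == _]eq_sym [c v == _]eq_sym.
case: eqP => [->|]; last by rewrite !mul0r.
by case: eqP => [->|]; rewrite ?mulr0 ?mul0r // mul1r; ring.
Qed.

Lemma sum_switch_removed G (w : 'I_n -> 'I_n -> R) : G \in Om ->
  \sum_a \sum_b \sum_u \sum_v switch_weight G a b u v * w a b =
  \sum_a \sum_b w a b * (G a b)%:R.
Proof.
move=> GO; apply: eq_bigr => a _; apply: eq_bigr => b _.
case Gab: (G a b); last first.
  rewrite mulr0 big1 // => u _; rewrite big1 // => v _.
  by rewrite /switch_weight Gab mulr0 !mul0r.
have M0 := edge_count_neq0 GO Gab.
transitivity (\sum_u \sum_v (c u == c a)%:R * (c v == c b)%:R * (G u v)%:R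
   * (w a b / edge_count (c a) (c b))).
  apply: eq_bigr => u _; apply: eq_bigr => v _.
  by rewrite /switch_weight Gab mulr1 [c u == _]eq_sym [c v == _]eq_sym; ring.
under eq_bigr do rewrite -mulr_suml.
by rewrite -mulr_suml sum_edges_of_type // mulr1 mulrC divfK.
Qed.

Lemma sum_switch_removed2 G (w : 'I_n -> 'I_n -> R) : G \in Om ->
  \sum_a \sum_b \sum_u \sum_v switch_weight G a b u v * w u v =
  \sum_a \sum_b w a b * (G a b)%:R.
Proof.
move=> GO; rewrite -sum_switch_removed //.
transitivity (\sum_a \sum_b \sum_u \sum_v switch_weight G u v a b * w u v).
  by do 4!(apply: eq_bigr => ? _); rewrite switch_weightC.
under eq_bigr => a _ do rewrite exchange_big.
rewrite exchange_big /=; apply: eq_bigr => u _.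
under eq_bigr => a _ do rewrite exchange_big.
by rewrite exchange_big.
Qed.

(** The pair av arises from a neighbour b of a and a neighbour u of v.  The
    degree conditions fix the number of both, so that the sum does not depend
    on the graph. *)
Lemma sum_switch_added G (w : 'I_n -> 'I_n -> R) : G \in Om ->
  \sum_a \sum_b \sum_u \sum_v switch_weight G a b u v * w a v =
  \sum_a \sum_v w a v * edge_density (c a) (c v).
Proof.
move=> GO; apply: eq_bigr => a _.
rewrite exchange_big /=.
under eq_bigr do rewrite exchange_big /=.
rewrite exchange_big /=.
under eq_bigr do rewrite exchange_big /=.
apply: eq_bigr => v _.
transitivity (\sum_b ((c b == c v)%:R * (G a b)%:R) *
   (\sum_u ((c u == c a)%:R * (G v u)%:R) * (w a v / edge_count (c a) (c v)))).
  apply: eq_bigr => b _; rewrite mulr_sumr; apply: eq_bigr => u _.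
  rewrite /switch_weight [c u == _]eq_sym (simple_graphC v u); last exact: frame_graph_simple GO.
  case: (c b =P c v) => [->|]; last by rewrite !(mulr0, mul0r).
  by rewrite mulr1 mul1r; ring.
rewrite -mulr_suml -mulr_suml !frame_graph_degree // /edge_density; ring.
Qed.

Lemma sum_switch_added2 G (w : 'I_n -> 'I_n -> R) : G \in Om ->
  \sum_a \sum_b \sum_u \sum_v switch_weight G a b u v * w u b =
  \sum_a \sum_v w a v * edge_density (c a) (c v).
Proof.
move=> GO; rewrite -(sum_switch_added w GO).
transitivity (\sum_a \sum_b \sum_u \sum_v switch_weight G u v a b * w u b).
  by do 4!(apply: eq_bigr => ? _); rewrite switch_weightC.
under eq_bigr => a _ do rewrite exchange_big.
rewrite exchange_big /=; apply: eq_bigr => u _.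
under eq_bigr => a _ do rewrite exchange_big.
by rewrite exchange_big.
Qed.

End FrameGraphs.

(** * The exponential moments of an edge sum *)

Section Concentration.
Variables (R : realType) (K : nat) (H : frame R K).
Variables (n : nat) (c : {ffun 'I_n -> 'I_K}).
Hypothesis cs : class_sizes H c.
Variables (Delta pmin : R).
Hypothesis Delta_ge : forall i, \sum_j (degree H i j)%:R <= Delta.
Hypothesis pmin_gt0 : 0 < pmin.
Hypothesis pmin_le : forall i, pmin <= weight H i.
Implicit Types (G : 'M[bool]_n) (a b u v x y : 'I_n) (i j : 'I_K).
Implicit Types (w : 'I_n -> 'I_n -> R).

Notation Om := (frame_graphs H c).
Notation q := (edge_density H n).

Lemma total_degreeE G u : G \in Om ->
  \sum_v (G u v)%:R = \sum_j (degree H (c u) j)%:R :> R.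
Proof.
move=> GO; under [RHS]eq_bigr do rewrite -(frame_graph_degree _ _ GO).
rewrite exchange_big /=; apply: eq_bigr => v _; rewrite -mulr_suml.
by rewrite (bigD1 (c v)) //= eqxx big1 ?addr0 ?mul1r // => j; rewrite eq_sym => /negbTE ->.
Qed.

Lemma total_degree_le G u : G \in Om -> \sum_v (G u v)%:R <= Delta.
Proof. by move=> GO; rewrite total_degreeE. Qed.

Lemma degree_le i j : (degree H i j)%:R <= Delta.
Proof. by apply: le_trans (Delta_ge i); rewrite (bigD1 j) //= lerDl sumr_ge0. Qed.

Lemma Delta_ge0 i : 0 <= Delta.
Proof. by apply: le_trans (Delta_ge i); rewrite sumr_ge0. Qed.

Lemma edge_density_le a i j : q i j <= Delta / (pmin * n%:R).
Proof.
have n0 := vertices_gt0 R a; have p0 := weight_gt0 H i.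
have [d0|d0] := eqVneq (degree H i j) 0%N.
  by rewrite /edge_density d0 !mul0r divr_ge0 ?(Delta_ge0 i) // mulr_ge0 // ltW.
have dr0 : (degree H i j)%:R != 0 :> R by rewrite pnatr_eq0.
have -> : q i j = (degree H j i)%:R / (weight H i * n%:R).
  by rewrite /edge_density /edge_count; field; rewrite dr0 !gt_eqF.
rewrite ler_pM ?degree_le // ?invr_ge0 ?mulr_ge0 // ?(ltW p0) // .
by rewrite lef_pV2 ?posrE ?mulr_gt0 // ler_pM2r.
Qed.

Lemma sum_edges_le G (z : 'I_n -> R) : G \in Om ->
  (forall u, 0 <= z u) -> \sum_u \sum_v z u * (G u v)%:R <= Delta * \sum_u z u.
Proof.
move=> GO z0; rewrite mulr_sumr; apply: ler_sum => u _.
by rewrite -mulr_sumr mulrC ler_wpM2r // total_degree_le.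
Qed.

Definition edge_sum w G : R := \sum_u \sum_v w u v * (G u v)%:R.
Definition edge_mean w : R := \sum_u \sum_v w u v * q (c u) (c v).

Definition switch_gain w a b u v : R := w a b + w u v - w a v - w u b.

Lemma edge_sum_switch w G a b u v : (forall x y, w x y = w y x) ->
  G \in Om -> switchable G a b u v ->
  edge_sum w G - edge_sum w (switch G a b u v) = 2 * switch_gain w a b u v.
Proof.
move=> wC GO sw; have sG := frame_graph_simple GO.
have [ab uv _ _] := switchable_neq sG sw.
have [av ub] : a != v /\ u != b by case/and5P: sw => _ _ _ _ /andP[].
have pick x0 y0 : \sum_x \sum_y w x y * ((x == x0)%:R * (y == y0)%:R) = w x0 y0.
  rewrite (bigD1 x0) //= [X in _ + X]big1 ?addr0 => [|x /negbTE ->]; last first.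
    by rewrite big1 // => y _; rewrite mul0r mulr0.
  rewrite (bigD1 y0) //= big1 ?addr0 => [|y /negbTE ->]; last by rewrite !mulr0.
  by rewrite !eqxx !mulr1.
have pick2 x0 y0 : x0 != y0 ->
    \sum_x \sum_y w x y * (joins x0 y0 x y)%:R = 2 * w x0 y0.
  move=> xy; under eq_bigr do under eq_bigr do rewrite joinsE // mulrDr.
  under eq_bigr do rewrite big_split; rewrite big_split /= !pick (wC y0); ring.
have -> : edge_sum w (switch G a b u v) = edge_sum w G
    - (\sum_x \sum_y w x y * (joins a b x y)%:R)
    - (\sum_x \sum_y w x y * (joins u v x y)%:R)
    + (\sum_x \sum_y w x y * (joins a v x y)%:R)
    + (\sum_x \sum_y w x y * (joins u b x y)%:R).
  rewrite /edge_sum -!sumrB -!big_split /=; apply: eq_bigr => x _.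
  rewrite -!sumrB -!big_split /=; apply: eq_bigr => y _.
  by rewrite switch_edge //; ring.
by rewrite !pick2 // /switch_gain; ring.
Qed.

(** Up to the switches that are not valid, the average change of an edge sum is
    a fixed multiple of its deviation from a constant. *)
Lemma sum_switch_gain w G : G \in Om ->
  \sum_a \sum_b \sum_u \sum_v switch_weight H c G a b u v * switch_gain w a b u v =
  2 * (edge_sum w G - edge_mean w).
Proof.
move=> GO; rewrite /edge_mean.
transitivity
  ((\sum_a \sum_b \sum_u \sum_v switch_weight H c G a b u v * w a b)
   + (\sum_a \sum_b \sum_u \sum_v switch_weight H c G a b u v * w u v)
   - (\sum_a \sum_b \sum_u \sum_v switch_weight H c G a b u v * w a v)
   - (\sum_a \sum_b \sum_u \sum_v switch_weight H c G a b u v * w u b)).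
  do 4!(rewrite -big_split -!sumrB; apply: eq_bigr => ? _) => /=.
  by rewrite /switch_gain; ring.
rewrite sum_switch_removed // sum_switch_removed2 // sum_switch_added //.
by rewrite sum_switch_added2 // /edge_sum; ring.
Qed.

Definition valid_switch G a b u v : bool :=
  [&& c a == c u, c b == c v & switchable G a b u v].

Lemma valid_switch_frame G a b u v : G \in Om -> valid_switch G a b u v ->
  switch G a b u v \in Om.
Proof. by move=> GO /and3P[/eqP au /eqP bv sw]; exact: switch_frame_graph. Qed.

Lemma valid_switch_switch G a b u v : G \in Om -> valid_switch G a b u v ->
  valid_switch (switch G a b u v) a v u b.
Proof.
move=> GO /and3P[au bv sw].
by rewrite /valid_switch au eq_sym bv switchable_switch ?(frame_graph_simple GO).
Qed.

Lemma switch_weight_switch G a b u v : G \in Om -> valid_switch G a b u v ->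
  switch_weight H c (switch G a b u v) a v u b = switch_weight H c G a b u v.
Proof.
move=> GO va; have vs := valid_switch_switch GO va.
case/and3P: va => /eqP au /eqP bv /and5P[Gab Guv _ _ _].
case/and3P: vs => _ _ /and5P[Gav Gub _ _ _].
by rewrite /switch_weight Gab Guv Gav Gub au bv.
Qed.

(** A switch fails only when av or ub is already an edge or would be a loop.
    There are O(n) such pairs, each of density O(1 / n), whence a bound
    independent of n. *)
Lemma sum_invalid_switch G (a0 : 'I_n) : G \in Om ->
  \sum_a \sum_b \sum_u \sum_v
     switch_weight H c G a b u v * (~~ valid_switch G a b u v)%:R <=
  2 * (Delta * (Delta + 1) / pmin).
Proof.
move=> GO.
pose w x y : R := (G x y)%:R + (x == y)%:R.
have wq : \sum_a \sum_v w a v * q (c a) (c v) <= Delta * (Delta + 1) / pmin.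
  have n0 := vertices_gt0 R a0.
  apply: (@le_trans _ _ (\sum_a \sum_v w a v * (Delta / (pmin * n%:R)))).
    apply: ler_sum => a _; apply: ler_sum => v _.
    by rewrite ler_wpM2l ?addr_ge0 // edge_density_le.
  under eq_bigr do rewrite -mulr_suml; rewrite -mulr_suml.
  apply: (@le_trans _ _ ((\sum_(i < n) (Delta + 1)) * (Delta / (pmin * n%:R)))).
    rewrite ler_wpM2r ?divr_ge0 ?(Delta_ge0 (c a0)) ?mulr_ge0 // ?(ltW pmin_gt0) //.
    apply: ler_sum => a _; rewrite big_split /= lerD ?total_degree_le //.
    by rewrite (bigD1 a) //= eqxx big1 ?addr0 // => x; rewrite eq_sym => /negbTE ->.
  rewrite sumr_const card_ord -mulr_natl.
  rewrite le_eqVlt; apply/orP; left; apply/eqP; field; rewrite !gt_eqF //.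
apply: (@le_trans _ _
  ((\sum_a \sum_b \sum_u \sum_v switch_weight H c G a b u v * w a v)
   + (\sum_a \sum_b \sum_u \sum_v switch_weight H c G a b u v * w u b))).
  rewrite -big_split; apply: ler_sum => a _; rewrite -big_split; apply: ler_sum => b _.
  rewrite -big_split; apply: ler_sum => u _; rewrite -big_split; apply: ler_sum => v _.
  rewrite /= -mulrDr.
  have [->|T0] := eqVneq (switch_weight H c G a b u v) 0; first by rewrite !mul0r.
  rewrite ler_wpM2l ?switch_weight_ge0 //.
  have [va|nva] := boolP (valid_switch _ _ _ _ _); first by rewrite !addr_ge0.
  move: T0 nva; rewrite /switch_weight /valid_switch /switchable /w.
  case: (c a == c u); last by rewrite !mul0r eqxx.
  case: (c b == c v); last by rewrite mulr0 !mul0r eqxx.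
  case: (G a b); last by rewrite mulr0 !mul0r eqxx.
  case: (G u v); last by rewrite mulr0 !mul0r eqxx.
  move=> _; case: (G a v); case: (G u b); case: (a == v); case: (u == b) => //= _; lra.
by rewrite sum_switch_added // sum_switch_added2 // -mulr2n -[leLHS]mulr_natl ler_wpM2l.
Qed.

Section ExponentialMoment.
Variables (w : 'I_n -> 'I_n -> R) (W V : R) (a0 : 'I_n).
Hypothesis wC : forall x y, w x y = w y x.
Hypothesis wW : forall x y, `|w x y| <= W.
Hypothesis wV : forall G, G \in Om -> \sum_x \sum_y w x y ^+ 2 * (G x y)%:R <= V.
Hypothesis wq : \sum_x \sum_y w x y ^+ 2 * q (c x) (c y) <= V.

Notation g G := (edge_sum w G - edge_mean w).

Let quad : finType := ('I_n * 'I_n * 'I_n * 'I_n)%type.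

Lemma sum_quadE (F : 'I_n -> 'I_n -> 'I_n -> 'I_n -> R) :
  \sum_a \sum_b \sum_u \sum_v F a b u v =
  \sum_(s : quad) F s.1.1.1 s.1.1.2 s.1.2 s.2.
Proof. by rewrite !pair_bigA. Qed.

Let T G (s : quad) := switch_weight H c G s.1.1.1 s.1.1.2 s.1.2 s.2.
Let gain (s : quad) := switch_gain w s.1.1.1 s.1.1.2 s.1.2 s.2.
Let valid G (s : quad) := valid_switch G s.1.1.1 s.1.1.2 s.1.2 s.2.
Let sw G (s : quad) := switch G s.1.1.1 s.1.1.2 s.1.2 s.2.
Let rev (s : quad) : quad := (s.1.1.1, s.2, s.1.2, s.1.1.2).

Lemma gain_sqr_le G : G \in Om -> \sum_s T G s * (2 * gain s) ^+ 2 <= 64 * V.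
Proof.
move=> GO.
apply: (@le_trans _ _ (\sum_(s : quad) (16 *
   (T G s * (w s.1.1.1 s.1.1.2 ^+ 2) + T G s * (w s.1.2 s.2 ^+ 2)
    + T G s * (w s.1.1.1 s.2 ^+ 2) + T G s * (w s.1.2 s.1.1.2 ^+ 2))))).
  apply: ler_sum => s _; rewrite -!mulrDr [leRHS]mulrCA ler_wpM2l ?switch_weight_ge0 //.
  rewrite /gain /switch_gain.
  move: (w _ _) (w _ _) (w _ _) (w _ _) => x y z t.
  have := sqr_ge0 (x - y); have := sqr_ge0 (x + z); have := sqr_ge0 (x + t).
  have := sqr_ge0 (y + z); have := sqr_ge0 (y + t); have := sqr_ge0 (z - t).
  by rewrite !expr2; nra.
rewrite -mulr_sumr !big_split /=.
have := sum_switch_removed cs (fun x y => w x y ^+ 2) GO.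
have := sum_switch_removed2 cs (fun x y => w x y ^+ 2) GO.
have := sum_switch_added (fun x y => w x y ^+ 2) GO.
have := sum_switch_added2 (fun x y => w x y ^+ 2) GO.
rewrite !sum_quadE /T /= => -> -> -> ->.
have := wV GO; move: wq; lra.
Qed.

Lemma expR_diff_le (x y : R) : (x - y) * (expR x - expR y) <= (x - y) ^+ 2 * (expR x + expR y).
Proof.
have step (s t : R) : s <= t -> (t - s) * (expR t - expR s) <= (t - s) ^+ 2 * (expR t + expR s).
  move=> st; rewrite expr2 -mulrA ler_wpM2l ?subr_ge0 //.
  have := expR_ge1Dx (s - t); rewrite expRD expRN => h.
  have t0 := expR_gt0 t; have s0 := expR_gt0 s.
  have {}h : expR t - expR s <= (t - s) * expR t.
    move: h; rewrite ler_pdivlMr // => h; lra.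
  by apply: le_trans h _; rewrite ler_wpM2l ?subr_ge0 // lerDl ltW.
have [xy|yx] := leP x y; last exact: step (ltW yx).
by have := step _ _ xy; rewrite -mulrNN !opprB -sqrrN opprB [expR y + _]addrC.
Qed.

Lemma switch_sum_sym (F : 'M[bool]_n -> 'M[bool]_n -> R) :
  \sum_(G in Om) \sum_(s | valid G s) T G s * F G (sw G s) =
  \sum_(G in Om) \sum_(s | valid G s) T G s * F (sw G s) G.
Proof.
rewrite !pair_big_dep /=.
pose iota (p : 'M[bool]_n * quad) := (sw p.1 p.2, rev p.2).
pose P (p : 'M[bool]_n * quad) := (p.1 \in Om) && valid p.1 p.2.
have Pi p : P p -> P (iota p).
  case: p => G [[[a b] u] v] /andP[GO va]; apply/andP; split.
    exact: valid_switch_frame.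
  exact: valid_switch_switch.
have ii p : P p -> iota (iota p) = p.
  case: p => G [[[a b] u] v] /andP[GO /and3P[_ _ sv]].
  by rewrite /iota /sw /rev /= switchK //; exact: frame_graph_simple GO.
rewrite (reindex_onto iota iota) //=; apply: eq_big => [p|p].
  apply/andP/idP => [[Pip /eqP <-]|Pp].
    exact: Pi.
  by rewrite ii // eqxx; split => //; exact: Pi.
case/andP => Pip /eqP iip; have : P p by rewrite -iip; exact: Pi.
case: p {Pip iip} => G [[[a b] u] v] /andP[GO va].
rewrite /T /sw /rev /= switch_weight_switch // switchK //.
  exact: frame_graph_simple GO.
by case/and3P: va.
Qed.

(** The method of exchangeable pairs.  By [sum_switch_gain], g G is essentially
    an average of g G - g G' over the switches G' of G.  Symmetrizing in G and G'
    replaces exp (th g G) by exp (th g G) - exp (th g G'), which costs a factor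
    th (g G - g G'), and the squares of these differences add up to at most
    64 V by [gain_sqr_le]. *)
Lemma exp_moment_derive_le (th : R) : 0 <= th ->
  \sum_(G in Om) g G * expR (th * g G) <=
  (16 * V * th + 4 * W * (Delta * (Delta + 1) / pmin)) * \sum_(G in Om) expR (th * g G).
Proof.
move=> th0; set e := fun G => expR (th * g G).
have e0 G : 0 <= e G by exact: expR_ge0.
have V0 G : G \in Om -> 0 <= V.
  by move=> GO; apply: le_trans (wV GO); do 2!(apply: sumr_ge0 => ? _); rewrite mulr_ge0 ?sqr_ge0.
have W0 : 0 <= W by apply: le_trans (wW a0 a0); exact: normr_ge0.
set I := Delta * (Delta + 1) / pmin.
have gE G : G \in Om -> 4 * (g G * e G) = \sum_s T G s * (2 * gain s) * e G.
  move=> GO; rewrite -mulr_suml; have := sum_switch_gain w GO.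
  rewrite sum_quadE => h.
  have -> : \sum_s T G s * (2 * gain s) = 2 * (2 * g G).
    by rewrite -h mulr_sumr; apply: eq_bigr => s _; rewrite mulrCA.
  by ring.
have validE G s : G \in Om -> valid G s -> 2 * gain s = g G - g (sw G s).
  move=> GO /and3P[_ _ sv].
  by rewrite opprB addrA subrK /sw (edge_sum_switch wC GO sv).
(* X is the contribution of the valid switches; reversing them exchanges G and
   its switch, hence antisymmetrizes the exponential. *)
pose X := \sum_(G in Om) \sum_(s | valid G s) T G s * ((g G - g (sw G s)) * e G).
have XE : 2 * X = \sum_(G in Om) \sum_(s | valid G s)
    T G s * ((g G - g (sw G s)) * (e G - e (sw G s))).
  rewrite mulr2n mulrDl mul1r {2}/X.
  rewrite (switch_sum_sym (fun G G' => (g G - g G') * e G)).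
  rewrite /X -big_split; apply: eq_bigr => G _; rewrite -big_split.
  by apply: eq_bigr => s _ /=; ring.
have XE2 : \sum_(G in Om) \sum_(s | valid G s)
    T G s * ((g G - g (sw G s)) ^+ 2 * (e G + e (sw G s))) =
    2 * \sum_(G in Om) \sum_(s | valid G s) T G s * ((g G - g (sw G s)) ^+ 2 * e G).
  rewrite [RHS]mulr_natl mulr2n.
  rewrite {2}(switch_sum_sym (fun G G' => (g G - g G') ^+ 2 * e G)).
  rewrite -big_split; apply: eq_bigr => G _; rewrite -big_split.
  by apply: eq_bigr => s _ /=; ring.
have Xle : X <= th * (64 * V) * \sum_(G in Om) e G.
  rewrite -(@ler_pM2l _ 2) // XE.
  apply: (@le_trans _ _ (th * \sum_(G in Om) \sum_(s | valid G s)
    T G s * ((g G - g (sw G s)) ^+ 2 * (e G + e (sw G s))))).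
    rewrite mulr_sumr; apply: ler_sum => G GO; rewrite mulr_sumr.
    apply: ler_sum => s _; rewrite [leRHS]mulrCA ler_wpM2l ?switch_weight_ge0 //.
    have [th00|thn0] := eqVneq th 0.
      by rewrite /e th00 !mul0r subrr mulr0.
    have th1 : 0 < th by rewrite lt_neqAle eq_sym thn0.
    rewrite -(ler_pM2l th1).
    have := expR_diff_le (th * g G) (th * g (sw G s)).
    by rewrite -mulrBr exprMn expr2 !mulrA.
  rewrite XE2 mulrCA ler_pM2l // -mulrA ler_wpM2l // mulr_sumr.
  apply: ler_sum => G GO.
  apply: (@le_trans _ _ ((\sum_s T G s * (2 * gain s) ^+ 2) * e G)); last first.
    by rewrite ler_wpM2r // gain_sqr_le.
  rewrite mulr_suml [leRHS](bigID (valid G)) /= -[leLHS]addr0 lerD //.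
    by apply: ler_sum => s vs; rewrite (validE G s GO vs) mulrA.
  by apply: sumr_ge0 => s _; rewrite mulr_ge0 // mulr_ge0 ?sqr_ge0 ?switch_weight_ge0.
rewrite -(@ler_pM2l _ 4) // mulr_sumr (eq_bigr _ gE).
under eq_bigr => G GO do rewrite (bigID (valid G)) /=.
rewrite big_split /=.
have -> : \sum_(G in Om) \sum_(s | valid G s) T G s * (2 * gain s) * e G = X.
  apply: eq_bigr => G GO; apply: eq_bigr => s vs.
  by rewrite (validE G s GO vs) mulrA.
(* For the remaining switches the gain is merely bounded by 4 W. *)
have rest : \sum_(G in Om) \sum_(s | ~~ valid G s) T G s * (2 * gain s) * e G
    <= (16 * W * I) * \sum_(G in Om) e G.
  rewrite mulr_sumr; apply: ler_sum => G GO; rewrite -mulr_suml ler_wpM2r //.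
  apply: (@le_trans _ _ (8 * W * \sum_s T G s * (~~ valid G s)%:R)); last first.
    have := sum_invalid_switch a0 GO; rewrite sum_quadE -/I => h.
    by apply: le_trans (ler_wpM2l _ h) _; rewrite ?mulr_ge0 //; lra.
  rewrite mulr_sumr [leRHS](bigID (valid G)) /= [X in _ <= X + _]big1 ?add0r => [|s ->]; last first.
    by rewrite !mulr0.
  apply: ler_sum => s ->; rewrite mulr1 mulrC ler_wpM2r ?switch_weight_ge0 //.
  rewrite /gain /switch_gain.
  move: (wW s.1.1.1 s.1.1.2) (wW s.1.2 s.2) (wW s.1.1.1 s.2) (wW s.1.2 s.1.1.2).
  by rewrite !ler_norml => /andP[? ?] /andP[? ?] /andP[? ?] /andP[? ?]; lra.
apply: le_trans (lerD Xle rest) _.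
by rewrite -mulrDl [leRHS]mulrA ler_wpM2r ?sumr_ge0 //; lra.
Qed.

End ExponentialMoment.

End Concentration.

(** * From exponential moments to a tail bound *)

Section ExponentialTail.
Variables (R : realType) (T : finType) (A : {set T}) (g : T -> R) (a b : R).
Hypothesis moment_derive_le : forall th : R, 0 <= th ->
  \sum_(x in A) g x * expR (th * g x) <=
  (2 * a * th + b) * \sum_(x in A) expR (th * g x).

(** The hypothesis makes the derivative of
    exp (- (a th^2 + b th)) (sum of exp (th g x)) nonpositive for th >= 0. *)
Lemma exp_moment_le (th : R) : 0 <= th ->
  \sum_(x in A) expR (th * g x) <= #|A|%:R * expR (a * th ^+ 2 + b * th).
Proof.
move=> th0.
pose k (i : 'I_#|A|) := g (enum_val i).
pose h (i : 'I_#|A|) (t : R) : R := expR (k i * t - (a * t ^+ 2 + b * t)).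
pose psi : R -> R := \sum_i h i.
have dh i (t : R) : is_derive t 1 (h i) (h i t * (k i - (2 * a * t + b))).
  rewrite /h; apply: (@is_derive1_comp R expR).
  by apply: is_derive_eq; rewrite /GRing.scale /=; ring.
have dpsi (t : R) : is_derive t 1 psi (\sum_i h i t * (k i - (2 * a * t + b))).
  exact: is_derive_sum.
have hE i t : h i t = expR (t * k i) * expR (- (a * t ^+ 2 + b * t)).
  by rewrite -expRD mulrC.
have psiE t : psi t = (\sum_(x in A) expR (t * g x)) * expR (- (a * t ^+ 2 + b * t)).
  rewrite (big_enum_val (fun x => expR (t * g x))) mulr_suml /psi fct_sumE.
  by apply: eq_bigr => i _; rewrite hE.
have psi0 : psi 0 = #|A|%:R.
  rewrite psiE !mulr0 expr0n mulr0 addr0 oppr0 expR0 mulr1.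
  under eq_bigr do rewrite mul0r expR0.
  by rewrite sumr_const.
have : psi th <= psi 0.
  have dle (t : R) : t \in `]0, th[ -> derive1 psi t <= 0.
    rewrite in_itv /= => /andP[t0 _].
    rewrite derive1E (@derive_val _ _ _ _ _ _ _ (dpsi t)).
    under eq_bigr do rewrite hE mulrAC mulrBr.
    rewrite -mulr_suml pmulr_lle0 ?expR_gt0 // sumrB subr_le0 -mulr_suml.
    under eq_bigr do rewrite mulrC.
    rewrite -(big_enum_val (fun x => g x * expR (t * g x))).
    rewrite -(big_enum_val (fun x => expR (t * g x))).
    by rewrite [leRHS]mulrC moment_derive_le // ltW.
  have dd (t : R) : derivable psi t 1 by have [] := dpsi t.
  apply: (@ler0_derive1_le_cc R psi 0 th) => //.
  - apply: continuous_subspaceT => t.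
    exact/differentiable_continuous/derivable1_diffP.
  - by rewrite in_itv /= lexx th0.
  - by rewrite in_itv /= lexx th0.
rewrite psiE psi0 expRN ler_pdivrMr ?expR_gt0 //.
Qed.

(** The Markov inequality at th = t / (4 a), which minimizes
    a th^2 + (t / 2) th - t th. *)
Lemma tail_count_le (t : R) : 0 < a -> 0 < t -> b <= t / 2 ->
  #|[set x in A | t <= g x]|%:R <= #|A|%:R * expR (- (t ^+ 2 / (16 * a))).
Proof.
move=> a0 t0 bt; set th := t / (4 * a).
have th0 : 0 < th by rewrite divr_gt0 ?mulr_gt0.
have := exp_moment_le (ltW th0).
have markov : #|[set x in A | t <= g x]|%:R * expR (th * t) <=
    \sum_(x in A) expR (th * g x).
  rewrite mulr_natl -sumr_const [leRHS](bigID (fun x => t <= g x)) /=.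
  rewrite -[leLHS]addr0 lerD ?sumr_ge0 //.
  under eq_bigl do rewrite inE.
  by apply: ler_sum => x /andP[_ tx]; rewrite ler_expR ler_pM2l.
move=> /(le_trans markov); rewrite -ler_pdivlMr ?expR_gt0 // -mulrA -expRN -expRD.
move=> /le_trans; apply; rewrite ler_wpM2l // ler_expR.
have -> : - (t ^+ 2 / (16 * a)) = a * th ^+ 2 + t / 2 * th - th * t.
  by rewrite /th; field; rewrite gt_eqF.
by rewrite lerD2r lerD2l ler_wpM2r // ltW.
Qed.

End ExponentialTail.

(** * The probability of containing given edges *)

Section EdgeContainment.
Variables (R : realType) (K : nat) (H : frame R K).
Variables (n : nat) (c : {ffun 'I_n -> 'I_K}).
Hypothesis cs : class_sizes H c.
Variables (Delta pmin : R).
Hypothesis Delta_ge : forall i, \sum_j (degree H i j)%:R <= Delta.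
Hypothesis pmin_gt0 : 0 < pmin.
Hypothesis pmin_le : forall i, pmin <= weight H i.
Implicit Types (G : 'M[bool]_n) (a b u v x y : 'I_n) (i j : 'I_K).
Implicit Types (F : {set 'I_n * 'I_n}).

Notation Om := (frame_graphs H c).

Definition graphs_containing F : {set 'M[bool]_n} :=
  [set G in Om | [forall p in F, G p.1 p.2]].

Lemma graphs_containingP G F :
  reflect (G \in Om /\ forall p, p \in F -> G p.1 p.2) (G \in graphs_containing F).
Proof.
rewrite [_ \in graphs_containing F]inE -/(G \in Om).
by apply: (iffP andP) => -[GO /forall_inP].
Qed.

Lemma sum_edges_bounded G (z : 'I_n -> 'I_n -> R) (y : 'I_n) (B : R) : G \in Om ->
  0 <= B -> (forall u v, 0 <= z u v) -> (forall v, \sum_u z u v <= B) ->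
  \sum_u \sum_v (G y v)%:R * z u v <= Delta * B.
Proof.
move=> GO B0 z0 zB; rewrite exchange_big /=.
apply: (@le_trans _ _ (\sum_v (G y v)%:R * B)).
  by apply: ler_sum => v _; rewrite -mulr_sumr ler_wpM2l.
by rewrite -mulr_suml ler_wpM2r // (total_degree_le Delta_ge _ GO).
Qed.

Let free G F a b u v : bool :=
  [&& valid_switch c G a b u v, (u, v) \notin F & (v, u) \notin F].

(** Among the edges uv that join the same classes as ab, at most
    2 Delta (Delta + 1) give an invalid switch, and at most 2 |F| belong to F in
    one of the two orientations. *)
Lemma sum_free_switch G F a b : G \in Om -> G a b ->
  edge_count H n (c a) (c b) - 2 * Delta * (Delta + 1) - 2 * #|F|%:R <=
  \sum_u \sum_v (free G F a b u v)%:R.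
Proof.
move=> GO Gab; have sG := frame_graph_simple GO.
have D0 : 0 <= Delta by exact: Delta_ge0 Delta_ge (c a).
have col v : \sum_u (G u v)%:R <= Delta.
  by under eq_bigr do rewrite simple_graphC //; exact: (total_degree_le Delta_ge _ GO).
have h1 := sum_edges_bounded a GO D0 (fun u v => ler0n R (G u v)) col.
have h2 : \sum_u \sum_v (G u b)%:R * (G u v)%:R <= Delta * Delta.
  under eq_bigr do rewrite -mulr_sumr.
  apply: (@le_trans _ _ (\sum_u (G u b)%:R * Delta)).
    by apply: ler_sum => u _; rewrite ler_wpM2l // (total_degree_le Delta_ge _ GO).
  by rewrite -mulr_suml ler_wpM2r.
have h3 : \sum_u \sum_v (a == v)%:R * (G u v)%:R <= Delta.
  under eq_bigr => u _.
    rewrite (bigD1 a) //= eqxx mul1r big1 ?addr0 => [|v]; last first.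
      by rewrite eq_sym => /negbTE ->; rewrite mul0r.
    over.
  exact: col.
have h4 : \sum_u \sum_v (u == b)%:R * (G u v)%:R <= Delta.
  rewrite (bigD1 b) //= [X in _ + X]big1 ?addr0 => [|u /negbTE ->]; last first.
    by rewrite big1 // => v _; rewrite mul0r.
  by under eq_bigr do rewrite eqxx mul1r; exact: (total_degree_le Delta_ge _ GO).
have h5 : \sum_u \sum_v ((u, v) \in F)%:R = #|F|%:R :> R.
  rewrite pair_bigA -sum1_card natr_sum [RHS]big_mkcond /=.
  by apply: eq_bigr => -[u v] _ /=; case: ifP.
have h6 : \sum_u \sum_v ((v, u) \in F)%:R = #|F|%:R :> R by rewrite exchange_big.
apply: (@le_trans _ _ (\sum_u \sum_v
  ((c u == c a)%:R * (c v == c b)%:R * (G u v)%:R - (G a v)%:R * (G u v)%:R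
   - (G u b)%:R * (G u v)%:R - (a == v)%:R * (G u v)%:R - (u == b)%:R * (G u v)%:R
   - ((u, v) \in F)%:R - ((v, u) \in F)%:R))).
  under [leRHS]eq_bigr do rewrite !(big_split, sumrN) /=.
  rewrite !(big_split, sumrN) /= (sum_edges_of_type cs _ _ GO) h5 h6; lra.
apply: ler_sum => u _; apply: ler_sum => v _.
rewrite /free /valid_switch /switchable Gab [c u == _]eq_sym [c v == _]eq_sym.
have nn (d : bool) : 0 <= d%:R :> R by rewrite ler0n.
have := nn ((u, v) \in F); have := nn ((v, u) \in F).
have := nn (G a v); have := nn (G u b); have := nn (a == v); have := nn (u == b).
case: (G u v); last by rewrite /= !andbF /= !mulr0; lra.
case: (c a == c u); last by rewrite /= !mul0r; lra.
case: (c b == c v); last by rewrite /= ?andbF /= !(mulr0, mul0r); lra.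
case: (G a v); first by rewrite /=; lra.
case: (G u b); first by rewrite /=; lra.
case: (a == v); first by rewrite /=; lra.
case: (u == b); first by rewrite /=; lra.
case: ((u, v) \in F); first by rewrite /=; lra.
case: ((v, u) \in F); by rewrite /=; lra.
Qed.

(** Double counting of the pairs of a graph G that contains ab and F and of an
    edge uv that can be switched with ab without touching F.  The new graph
    contains F and determines G once uv is known; since v is a neighbour of a in
    it and u a neighbour of b, it arises from at most
    [degree H (c a) (c b) * degree H (c b) (c a)] edges uv. *)
Lemma contain_switch F a b (M2 : R) : (a, b) \notin F -> (b, a) \notin F ->
  0 < M2 ->
  M2 <= edge_count H n (c a) (c b) - 2 * Delta * (Delta + 1) - 2 * #|F|%:R ->
  #|graphs_containing ((a, b) |: F)|%:R * M2 <=
  #|graphs_containing F|%:R * ((degree H (c a) (c b))%:R * (degree H (c b) (c a))%:R).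
Proof.
move=> abF baF M20 M2le.
pose S1 := [set p : 'M[bool]_n * ('I_n * 'I_n) |
  (p.1 \in graphs_containing ((a, b) |: F)) && free p.1 F a b p.2.1 p.2.2].
pose S2 := [set p : 'M[bool]_n * ('I_n * 'I_n) |
  (p.1 \in graphs_containing F) &&
  [&& c p.2.1 == c a, c p.2.2 == c b, p.1 a p.2.2 & p.1 b p.2.1]].
have cardS (P : 'M[bool]_n * ('I_n * 'I_n) -> bool) (B : {set 'M[bool]_n}) :
    #|[set p | (p.1 \in B) && P p]|%:R =
    \sum_(G in B) \sum_u \sum_v (P (G, (u, v)))%:R :> R.
  rewrite -sum1_card natr_sum.
  under [RHS]eq_bigr do rewrite pair_bigA.
  rewrite pair_big_dep /= [RHS](bigID P) /= [X in _ = _ + X]big1 ?addr0; last first.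
    by case=> G [u v] /andP[_ /negbTE] /= ->.
  apply: eq_big => [p|]; first by rewrite inE andbT.
  by case=> G [u v]; rewrite inE => /andP[_ /= ->].
have S1S2 : (#|S1| <= #|S2|)%N.
  pose f (p : 'M[bool]_n * ('I_n * 'I_n)) := (switch p.1 a b p.2.1 p.2.2, p.2).
  rewrite -(@card_in_imset _ _ f S1).
    apply: subset_leq_card; apply/fintype.subsetP => _ /imsetP[[G [u v]] h ->].
    move: h; rewrite [_ \in S1]inE /= => /andP[/graphs_containingP[GO Gc]].
    move=> /and3P[/and3P[/eqP au /eqP bv sw] uvF vuF].
    have sG := frame_graph_simple GO.
    rewrite [_ \in S2]inE /f /= au bv !eqxx /=; apply/andP; split; last first.
      have /and5P[-> Gub _ _ _] := switchable_switch sG sw.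
      by rewrite (simple_graphC b u) ?Gub ?switch_simple.
    apply/graphs_containingP; split; first exact: switch_frame_graph.
    case=> x y xyF /=.
    have Gxy : G x y by apply: (Gc (x, y)); rewrite !inE xyF orbT.
    rewrite mxE Gxy /joins /=.
    have ne p q : (p, q) \notin F -> (x == p) && (y == q) = false.
      by apply: contraNF => /andP[/eqP <- /eqP <-].
    by rewrite (ne _ _ abF) (ne _ _ baF) (ne _ _ uvF) (ne _ _ vuF).
  move=> [G [u v]] [G' [u' v']]; rewrite ![_ \in S1]inE /=.
  move=> /andP[/graphs_containingP[/frame_graph_simple sG _] /and3P[/and3P[_ _ sw] _ _]].
  move=> /andP[/graphs_containingP[/frame_graph_simple sG' _] /and3P[/and3P[_ _ sw'] _ _]].
  move=> [e eu ev]; subst u' v'.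
  by rewrite -(switchK sG sw) e switchK.
have S1E := cardS (fun p => free p.1 F a b p.2.1 p.2.2) (graphs_containing ((a, b) |: F)).
have S2E := cardS (fun p => [&& c p.2.1 == c a, c p.2.2 == c b, p.1 a p.2.2
   & p.1 b p.2.1]) (graphs_containing F).
apply: (@le_trans _ _ #|S1|%:R).
  rewrite /S1 S1E mulr_natl -sumr_const; apply: ler_sum => G.
  move=> /graphs_containingP[GO /(_ (a, b) (setU11 _ _)) /= Gab].
  exact: le_trans M2le (sum_free_switch _ GO Gab).
apply: (@le_trans _ _ #|S2|%:R); first by rewrite ler_nat.
rewrite /S2 S2E mulr_natl -sumr_const; apply: ler_sum => G.
move=> /graphs_containingP[GO _].
rewrite -(frame_graph_degree a (c b) GO) -(frame_graph_degree b (c a) GO).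
rewrite mulrC mulr_suml; apply: ler_sum => u _; rewrite mulr_sumr; apply: ler_sum => v _.
by rewrite -!natrM !mulnb ler_nat; case: (c u == c a) (c v == c b) (G a v) (G b u) => [] [] [] [].
Qed.

(** The edges of F are removed one at a time with [contain_switch].  Taking the
    pairs increasing makes distinct elements of F distinct edges. *)
Lemma card_graphs_containing F (k : nat) :
  (forall p, p \in F -> (p.1 < p.2)%N) -> (#|F| <= k)%N ->
  (forall i j, degree H i j != 0%N ->
     2 * Delta * (Delta + 1) + 2 * k%:R <= edge_count H n i j / 2) ->
  #|graphs_containing F|%:R <= #|Om|%:R * (2 * Delta / (pmin * n%:R)) ^+ #|F|.
Proof.
move=> Flt Fk Mge; move: {2}#|F| (erefl #|F|) => m.
elim: m F Flt Fk => [|m IH] F Flt Fk Fm.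
  rewrite Fm expr0 mulr1 ler_nat; apply: subset_leq_card; apply/fintype.subsetP => G.
  by case/graphs_containingP.
have [p pF] : exists p, p \in F by apply/card_gt0P; rewrite Fm.
case: p pF => a b abF; set F' := F :\ (a, b).
have FE : F = (a, b) |: F' by rewrite finset.setD1K.
have F'm : #|F'| = m by apply/eqP; rewrite -eqSS -Fm (cardsD1 (a, b) F) abF.
have F'lt p : p \in F' -> (p.1 < p.2)%N by rewrite inE => /andP[_ /Flt].
have F'k : (#|F'| <= k)%N by rewrite (leq_trans _ Fk) // F'm Fm.
have ab := Flt _ abF; rewrite /= in ab.
have D0 : 0 <= Delta by exact: Delta_ge0 Delta_ge (c a).
have n0 := vertices_gt0 R a.
set r := 2 * Delta / (pmin * n%:R).
have r0 : 0 <= r by rewrite divr_ge0 ?mulr_ge0 // ltW.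
apply: (@le_trans _ _ (#|graphs_containing F'|%:R * r)); last first.
  by rewrite Fm exprSr mulrA ler_wpM2r // -F'm IH.
have [d0|d0] := eqVneq (degree H (c a) (c b)) 0%N.
  have -> : graphs_containing F = finset.set0; last by rewrite cards0 mulr_ge0.
  apply/finset.setP => G; rewrite finset.in_set0; apply/negP => /graphs_containingP[GO].
  move=> /(_ (a, b) abF) /= Gab; have := edge_count_neq0 GO Gab.
  by rewrite /edge_count d0 mulr0 eqxx.
set M := edge_count H n (c a) (c b).
have M0 : 0 < M.
  rewrite /M /edge_count !mulr_gt0 ?weight_gt0 // ltr0n lt0n //.
have MM := Mge _ _ d0; rewrite -/M in MM.
have := @contain_switch F' a b (M / 2).
rewrite -FE => /(_ _ _ _ _) H1.
have {}H1 : #|graphs_containing F|%:R * (M / 2) <= #|graphs_containing F'|%:R *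
     ((degree H (c a) (c b))%:R * (degree H (c b) (c a))%:R).
  apply: H1; rewrite ?divr_gt0 //.
  - by rewrite /F' !inE eqxx.
  - by apply/negP => /F'lt /= ba; have := ltn_trans ab ba; rewrite ltnn.
  - have : #|F'|%:R <= k%:R :> R by rewrite ler_nat.
    by rewrite -/M; lra.
move: H1; rewrite -ler_pdivlMr ?divr_gt0 // => H1.
apply: le_trans H1 _; rewrite -mulrA ler_wpM2l //.
have := edge_density_le Delta_ge pmin_gt0 pmin_le a (c a) (c b).
rewrite /edge_density -/M /r => qle.
by rewrite invf_div mulrA [_ * _ * 2]mulrC -!mulrA ler_wpM2l // !mulrA.
Qed.

End EdgeContainment.

(** * Estimates for the number of small dense sets *)

Lemma bin_le_exp2 (m k : nat) : ('C(m, k) <= 2 ^ m)%N.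
Proof.
have [km|mk] := leqP k m; last by rewrite bin_small.
have := expnDn 1 1 m; rewrite addn1 => ->.
rewrite (bigD1 (Ordinal (km : k < m.+1)%N)) //= !exp1n !muln1.
exact: leq_addr.
Qed.

(** A weak form of k^k <= e^k k!, by comparing k^k with the product
    (k + 1) ... (2 k) = k! 'C(2 k, k). *)
Lemma expnn_le_fact (k : nat) : (k ^ k <= 4 ^ k * k`!)%N.
Proof.
have h1 : (k ^ k <= (2 * k) ^_ k)%N.
  rewrite ffact_prod -[X in (_ ^ X <= _)%N](card_ord k) -prod_nat_const.
  by apply: leq_prod => i _; rewrite mul2n -addnn -addnBA ?leq_addr // ltnW.
apply: (leq_trans h1); rewrite -bin_ffact leq_mul2r; apply/orP; right.
by rewrite (_ : 4 = 2 ^ 2)%N // -expnM bin_le_exp2.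
Qed.

Lemma bin_expnn_le (m k : nat) : ('C(m, k) * k ^ k <= (4 * m) ^ k)%N.
Proof.
apply: (@leq_trans ('C(m, k) * (4 ^ k * k`!))); first by rewrite leq_mul2l expnn_le_fact orbT.
rewrite mulnCA bin_ffact expnMn leq_mul2l; apply/orP; right.
elim: k m => // k IH m; rewrite ffactnS expnS leq_mul2l; apply/orP; right.
apply: (leq_trans (IH m.-1)).
by case: k {IH} => // k; rewrite leq_exp2r // leq_pred.
Qed.

Lemma bin_le_expr (R : realType) (m k : nat) : (0 < k)%N ->
  'C(m, k)%:R <= (4 * m%:R / k%:R) ^+ k :> R.
Proof.
move=> k0; have kr0 : 0 < k%:R :> R by rewrite ltr0n.
rewrite expr_div_n ler_pdivlMr ?exprn_gt0 //.
by rewrite -natrX -natrM -natrM -natrX ler_nat bin_expnn_le.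
Qed.

Lemma sum_half_le1 (R : realType) (n : nat) : \sum_(s < n) (2^-1 ^+ s.+1) <= 1 :> R.
Proof.
have -> : \sum_(s < n) (2^-1 ^+ s.+1) = 1 - 2^-1 ^+ n :> R.
  elim: n => [|n IH]; first by rewrite big_ord0 expr0 subrr.
  by rewrite big_ord_recr /= IH exprS; field.
by rewrite gerBl exprn_ge0 // invr_ge0.
Qed.

(** With x = B s / n the left-hand side is at most ((4 B / x) x^alpha)^s, by
    [bin_le_expr].  The conditions on B make the base at most x / 4; so the
    whole is at most x 4^-s, and 2^-s absorbs the factor s of x. *)
Lemma dense_term_le (R : realType) (n s alpha : nat) (r B sigma : R) :
  (0 < s)%N -> (2 < alpha)%N -> (0 < n)%N -> 0 < r -> B = 4 * r / alpha%:R ->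
  B * sigma <= 1 -> 16 * B ^+ 2 * sigma <= 1 -> s%:R <= sigma * n%:R ->
  'C(n, s)%:R * ('C(s ^ 2, alpha * s)%:R * (r / n%:R) ^+ (alpha * s)) <=
  B / n%:R * 2^-1 ^+ s.
Proof.
move=> s0 a3 n0 r0 BE Bs1 Bs2 sn.
have sr0 : 0 < s%:R :> R by rewrite ltr0n.
have nr0 : 0 < n%:R :> R by rewrite ltr0n.
have ar0 : 0 < alpha%:R :> R by rewrite ltr0n (ltn_trans _ a3).
have B0 : 0 < B by rewrite BE divr_gt0 ?mulr_gt0.
set x := B * s%:R / n%:R.
have x0 : 0 < x by rewrite !mulr_gt0 ?invr_gt0.
have xs : x <= B * sigma by rewrite /x ler_pdivrMr // -mulrA ler_pM2l.
have x1 : x <= 1 by exact: le_trans Bs1.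
have base : (4 * n%:R / s%:R) * x ^+ alpha <= x / 4.
  have -> : 4 * n%:R / s%:R = 4 * B / x by rewrite /x; field; rewrite !gt_eqF.
  have -> : alpha = (alpha - 3).+3 by rewrite -addn3 subnK.
  rewrite 3!exprS.
  have -> : 4 * B / x * (x * (x * (x * x ^+ (alpha - 3)))) =
     x * (4 * (B * x) * x ^+ (alpha - 3)) by field; rewrite gt_eqF.
  rewrite ler_wpM2l ?(ltW x0) //.
  have Bx : B * x <= B * (B * sigma) by rewrite ler_pM2l.
  apply: (@le_trans _ _ (4 * (B * x) * 1)).
    by rewrite ler_wpM2l ?mulr_ge0 ?(ltW B0) ?(ltW x0) // exprn_ile1 // ltW.
  by rewrite mulr1; move: Bx Bs2; rewrite expr2 !mulrA; lra.
have h1 : 'C(n, s)%:R <= (4 * n%:R / s%:R) ^+ s :> R by exact: bin_le_expr.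
have h2 : 'C(s ^ 2, alpha * s)%:R * (r / n%:R) ^+ (alpha * s) <= (x ^+ alpha) ^+ s.
  have as0 : (0 < alpha * s)%N by rewrite muln_gt0 s0 (ltn_trans _ a3).
  have -> : x = (4 * (s ^ 2)%:R / (alpha * s)%:R) * (r / n%:R).
    by rewrite /x BE natrX natrM; field; rewrite !gt_eqF.
  rewrite -exprM [leRHS]exprMn ler_wpM2r ?exprn_ge0 ?divr_ge0 ?(ltW r0) //.
  exact: bin_le_expr.
apply: (@le_trans _ _ ((x / 4) ^+ s)).
  apply: le_trans (ler_pM _ _ h1 h2) _ => //.
    by rewrite mulr_ge0 // exprn_ge0 // divr_ge0 // ltW.
  rewrite -exprMn lerXn2r ?nnegrE ?mulr_ge0 ?exprn_ge0 ?invr_ge0 ?(ltW x0) //.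
  exact: ltW.
have xsx : x ^+ s <= x.
  by rewrite -(prednK s0) exprS ler_piMr ?(ltW x0) // exprn_ile1 // ltW.
rewrite exprMn; apply: (@le_trans _ _ (x * 4^-1 ^+ s)).
  by rewrite ler_wpM2r // exprn_ge0 // invr_ge0.
have -> : 4^-1 = 2^-1 * 2^-1 :> R by field.
rewrite exprMn mulrA ler_wpM2r ?exprn_ge0 ?invr_ge0 //.
rewrite /x mulrAC ler_wpM2r ?invr_ge0 // -mulrA ler_piMr ?(ltW B0) //.
by rewrite exprVn ler_pdivrMr ?exprn_gt0 // mul1r -natrX ler_nat ltnW // ltn_expl.
Qed.

(** * Small dense sets are unlikely *)

Section SparseSpots.
Variables (R : realType) (K : nat) (H : frame R K).
Variables (n : nat) (c : {ffun 'I_n -> 'I_K}).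
Hypothesis cs : class_sizes H c.
Variables (Delta pmin : R).
Hypothesis Delta_ge : forall i, \sum_j (degree H i j)%:R <= Delta.
Hypothesis Delta_gt0 : 0 < Delta.
Hypothesis pmin_gt0 : 0 < pmin.
Hypothesis pmin_le : forall i, pmin <= weight H i.
Variables (alpha : nat) (sigma : R).
Implicit Types (G : 'M[bool]_n) (T : {set 'I_n}) (F : {set 'I_n * 'I_n}).

Notation Om := (frame_graphs H c).

Definition pairs_in T : {set 'I_n * 'I_n} :=
  [set p : 'I_n * 'I_n | [&& (p.1 < p.2)%N, p.1 \in T & p.2 \in T]].

Definition edges_in G T : {set 'I_n * 'I_n} :=
  [set p in pairs_in T | G p.1 p.2].

Definition dense_spot G T : bool :=
  [&& (0 < #|T|)%N, #|T|%:R <= sigma * n%:R & (alpha * #|T| < #|edges_in G T|)%N].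

Lemma card_pairs_in T : (#|pairs_in T| <= #|T| ^ 2)%N.
Proof.
rewrite expnS expn1 -cardsX; apply: subset_leq_card; apply/fintype.subsetP => -[a b].
by rewrite !inE /= => /and3P[_ -> ->].
Qed.

(** First moment: T is chosen among the sets of size s, then alpha s pairs
    among the at most s^2 pairs in T, and all of them are edges with the
    probability bounded by [card_graphs_containing]. *)
Lemma card_dense_graphs (B : R) : (0 < n)%N -> (2 < alpha)%N ->
  (forall i j, degree H i j != 0%N ->
     2 * Delta * (Delta + 1) + 2 * (alpha%:R * (sigma * n%:R)) <= edge_count H n i j / 2) ->
  B = 8 * Delta / (pmin * alpha%:R) -> B * sigma <= 1 -> 16 * B ^+ 2 * sigma <= 1 ->
  #|[set G in Om | [exists T, dense_spot G T]]|%:R <= #|Om|%:R * (B / n%:R).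
Proof.
move=> n0 a3 Mge BE Bs1 Bs2.
have nr0 : 0 < n%:R :> R by rewrite ltr0n.
have ar0 : 0 < alpha%:R :> R by rewrite ltr0n (ltn_trans _ a3).
have B0 : 0 < B by rewrite BE divr_gt0 ?mulr_gt0.
pose ok T := (0 < #|T|)%N && (#|T|%:R <= sigma * n%:R).
pose draws T := [set F : {set 'I_n * 'I_n} | F \subset pairs_in T & #|F| == (alpha * #|T|)%N].
have union_bound : #|[set G in Om | [exists T, dense_spot G T]]|%:R <=
    \sum_(T | ok T) \sum_(F in draws T) #|graphs_containing H c F|%:R :> R.
  have gcE F : #|graphs_containing H c F|%:R =
      \sum_(G in Om) (G \in graphs_containing H c F)%:R :> R.
    rewrite -sum1_card natr_sum big_mkcond [RHS]big_mkcond; apply: eq_bigr => G _.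
    case: ifP => [GF|_]; last by case: ifP.
    by have [-> _] := graphs_containingP _ _ _ _ GF.
  under eq_bigr do under eq_bigr do rewrite gcE.
  under eq_bigr do rewrite exchange_big.
  rewrite exchange_big /= -sum1_card natr_sum.
  rewrite [leRHS](bigID (fun G => [exists T, dense_spot G T])) /= -[leLHS]addr0.
  rewrite lerD ?sumr_ge0 // => [|G _]; last first.
    by rewrite sumr_ge0 // => T _; rewrite sumr_ge0.
  under eq_bigl do rewrite finset.in_set.
  apply: ler_sum => G /andP[GO /existsP[T /and3P[T0 Ts Td]]].
  rewrite (bigD1 T) /=; last by rewrite /ok T0.
  have [F] : exists F, F \in [set F : {set 'I_n * 'I_n} | F \subset edges_in G T
                              & #|F| == (alpha * #|T|)%N].
    by apply/card_gt0P; rewrite cards_draws bin_gt0 ltnW.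
  rewrite finset.in_set => /andP[FG /eqP Fk].
  rewrite (bigD1 F) /=; last first.
    rewrite finset.in_set Fk eqxx andbT; apply: fintype.subset_trans FG _.
    by apply/fintype.subsetP => p; rewrite finset.in_set => /andP[].
  have -> : G \in graphs_containing H c F.
    apply/graphs_containingP; split=> // p pF.
    by have := fintype.subsetP FG _ pF; rewrite finset.in_set => /andP[].
  rewrite -addrA lerDl addr_ge0 ?sumr_ge0 // => T' _.
  by rewrite sumr_ge0.
apply: (le_trans union_bound).
set r := 2 * Delta / pmin.
have r0 : 0 < r by rewrite divr_gt0 ?mulr_gt0.
have Br : B = 4 * r / alpha%:R by rewrite BE /r; field; rewrite !gt_eqF.
pose t s : R := 'C(s ^ 2, alpha * s)%:R * (r / n%:R) ^+ (alpha * s).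
have t0 s : 0 <= t s by rewrite /t mulr_ge0 // exprn_ge0 // divr_ge0 // ltW.
have step1 T : ok T -> \sum_(F in draws T) #|graphs_containing H c F|%:R <=
    #|Om|%:R * t #|T|.
  case/andP=> T0 Ts.
  apply: (@le_trans _ _ (\sum_(F in draws T) #|Om|%:R * (r / n%:R) ^+ (alpha * #|T|))).
    apply: ler_sum => F; rewrite finset.in_set => /andP[/fintype.subsetP FT /eqP Fk].
    rewrite -Fk (_ : r / n%:R = 2 * Delta / (pmin * n%:R)); last first.
      by rewrite /r; field; rewrite !gt_eqF.
    apply: (card_graphs_containing cs Delta_ge pmin_gt0 pmin_le (k := #|F|)) => //.
      by move=> p /FT; rewrite finset.in_set => /andP[].
    move=> i j d0; apply: le_trans (Mge i j d0).
    by rewrite Fk lerD2l ler_wpM2l // natrM ler_wpM2l.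
  rewrite sumr_const cards_draws /t -[leLHS]mulr_natl mulrCA ler_wpM2l //.
  rewrite ler_wpM2r ?ler_nat ?leq_bin2l ?card_pairs_in //.
  by rewrite exprn_ge0 // divr_ge0 // ltW.
apply: le_trans (ler_sum _ step1) _.
rewrite -mulr_sumr ler_wpM2l //.
pose inr (T : {set 'I_n}) : 'I_n.+1 := inord #|T|.
have inrE T : inr T = #|T| :> nat.
  by rewrite inordK // ltnS -[X in (_ <= X)%N](card_ord n) max_card.
rewrite (partition_big inr xpredT) //=.
apply: (@le_trans _ _ (\sum_(s < n.+1 | (0 < s)%N) B / n%:R * 2^-1 ^+ s)); last first.
  rewrite big_mkcond big_ord_recl /= add0r -mulr_sumr ler_piMr ?divr_ge0 ?(ltW B0) //.
  exact: sum_half_le1.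
rewrite [leRHS]big_mkcond /=; apply: ler_sum => s _.
case: ifP => s0; last first.
  rewrite big1 // => T /andP[/andP[T0 _] /eqP sT].
  by rewrite -sT inrE T0 in s0.
have [sn|sn] := leP s%:R (sigma * n%:R); last first.
  rewrite big1 ?mulr_ge0 ?exprn_ge0 ?invr_ge0 ?(ltW B0) // => T /andP[/andP[_ Ts] /eqP sT].
  by move: sn; rewrite -sT inrE ltNge Ts.
apply: le_trans (dense_term_le s0 a3 n0 r0 Br Bs1 Bs2 sn).
rewrite -/(t s); have := card_draws 'I_n s; rewrite card_ord => <-.
apply: (@le_trans _ _ (\sum_(T : {set 'I_n} | #|T| == s) t s)).
  rewrite big_mkcond [leRHS]big_mkcond /=; apply: ler_sum => T _.
  case: ifP => [/andP[_ /eqP sT]|_]; last by case: ifP.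
  by rewrite -{1 2}sT inrE eqxx.
rewrite sumr_const -[leLHS]mulr_natl cardsE.
by [].
Qed.

End SparseSpots.

(** * A net for quadratic forms *)

Lemma leq_sqr (m : nat) : (m <= m ^ 2)%N.
Proof. by case: m => // m; rewrite expnS expn1 leq_pmulr. Qed.

Section QuadraticForms.
Variables (R : realType) (n : nat) (B : 'I_n -> 'I_n -> R).
Hypothesis BC : forall u v, B u v = B v u.
Implicit Types (x y p s : 'I_n -> R).

Definition bform x y : R := \sum_u \sum_v B u v * (x u * y v).
Definition norm2 x : R := \sum_u x u ^+ 2.

Lemma bformC x y : bform x y = bform y x.
Proof.
rewrite /bform exchange_big /=; apply: eq_bigr => u _; apply: eq_bigr => v _.
by rewrite BC [x _ * _]mulrC.
Qed.

Lemma bformZ (a b : R) x y :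
  bform (fun u => a * x u) (fun u => b * y u) = a * b * bform x y.
Proof.
rewrite mulr_sumr; apply: eq_bigr => u _; rewrite mulr_sumr.
by apply: eq_bigr => v _; ring.
Qed.

Lemma bformDl x y p : bform (fun u => x u + y u) p = bform x p + bform y p.
Proof.
rewrite -big_split; apply: eq_bigr => u _; rewrite -big_split.
by apply: eq_bigr => v _ /=; ring.
Qed.

Lemma bformDr x y p : bform p (fun u => x u + y u) = bform p x + bform p y.
Proof. by rewrite bformC bformDl !(bformC p). Qed.

Lemma norm2_ge0 x : 0 <= norm2 x.
Proof. by apply: sumr_ge0 => u _; rewrite sqr_ge0. Qed.

Lemma norm2Z (a : R) x : norm2 (fun u => a * x u) = a ^+ 2 * norm2 x.
Proof. by rewrite mulr_sumr; apply: eq_bigr => u _; rewrite exprMn. Qed.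

Lemma norm2_coord x u : x u ^+ 2 <= norm2 x.
Proof. by rewrite /norm2 (bigD1 u) //= lerDl sumr_ge0 // => v _; rewrite sqr_ge0. Qed.

(** Polarization with 8 p and s, a scaling adapted to |s|^2 = 64 |p|^2, which is
    the ratio met in [net_bound_step]. *)
Lemma bform_polar_le (L : R) p s : 0 <= L ->
  (forall x, `|bform x x| <= L * norm2 x) ->
  `|bform p s| <= L / 2 * (8 * norm2 p + norm2 s / 8).
Proof.
move=> L0 hL.
pose x u := 8 * p u + 1 * s u; pose y u := 8 * p u + -1 * s u.
have e : 32 * bform p s = bform x x - bform y y.
  by rewrite /x /y !(bformDl, bformDr) !bformZ (bformC s p); ring.
have ne : norm2 x + norm2 y = 2 * (64 * norm2 p + norm2 s).
  rewrite /norm2 -big_split !mulr_sumr -big_split mulr_sumr /=.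
  by apply: eq_bigr => u _; rewrite /x /y; ring.
have := hL x; have := hL y; rewrite !ler_norml => /andP[y1 y2] /andP[x1 x2].
have Lne : L * norm2 x + L * norm2 y = L * (2 * (64 * norm2 p + norm2 s)).
  by rewrite -mulrDr ne.
by apply/andP; split; lra.
Qed.

Lemma bform_trivial_bound x :
  `|bform x x| <= (\sum_u \sum_v `|B u v|) * norm2 x.
Proof.
rewrite /bform mulr_suml; apply: le_trans (ler_norm_sum _ _ _) _.
apply: ler_sum => u _; rewrite mulr_suml; apply: le_trans (ler_norm_sum _ _ _) _.
apply: ler_sum => v _; rewrite normrM ler_wpM2l //.
have := norm2_coord x u; have := norm2_coord x v.
rewrite ler_norml => hu hv; have := sqr_ge0 (x u - x v); have := sqr_ge0 (x u + x v).
by rewrite sqrrD sqrrB => ? ?; apply/andP; split; lra.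
Qed.

Let net := {ffun 'I_n -> bool * 'I_(16 * n).+1}.

(** The net consists of the points of norm2 at most n with coordinates in Z / 4.
    A coordinate is coded by its sign and absolute value k / 4; as k <= k^2, the
    range k <= 16 n is large enough. *)
Definition net_point (z : net) (u : 'I_n) : R := (-1) ^+ (z u).1 * (z u).2%:R / 4.

Definition in_net (z : net) : bool := (\sum_u (z u).2 ^ 2 <= 16 * n)%N.

Lemma norm2_net_point z : in_net z -> norm2 (net_point z) <= n%:R.
Proof.
rewrite /in_net -(ler_nat R) natr_sum natrM => h.
rewrite -(@ler_pM2l _ 16) //; apply: le_trans h.
rewrite mulr_sumr le_eqVlt; apply/orP; left; apply/eqP; apply: eq_bigr => u _.
by rewrite /net_point 2!exprMn sqrr_sign natrX; field.
Qed.

(** Rounding towards zero does not increase the coordinates, so it stays in the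
    ball. *)
Lemma net_approx x : norm2 x = n%:R -> exists2 z, in_net z &
  forall u, net_point z u ^+ 2 <= x u ^+ 2 /\ (x u - net_point z u) ^+ 2 <= 16^-1.
Proof.
move=> xn.
pose k u := Num.truncn `|4 * x u|.
have k_le u : (k u)%:R <= `|4 * x u| by have /andP[] := truncn_itv (normr_ge0 (4 * x u)).
have k_gt u : `|4 * x u| <= (k u)%:R + 1.
  by rewrite natr1; have /andP[_ /ltW] := truncn_itv (normr_ge0 (4 * x u)).
have k2 u : ((k u) ^ 2)%:R <= 16 * x u ^+ 2 :> R.
  have -> : 16 * x u ^+ 2 = `|4 * x u| ^+ 2 by rewrite real_normK ?num_real //; ring.
  by rewrite natrX lerXn2r ?nnegrE.
have ksum : (\sum_u k u ^ 2 <= 16 * n)%N.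
  rewrite -(ler_nat R) natr_sum natrM -xn mulr_sumr.
  by apply: ler_sum => u _; exact: k2.
have kb u : (k u < (16 * n).+1)%N.
  rewrite ltnS; apply: leq_trans ksum; rewrite (bigD1 u) //=.
  by apply: leq_trans (leq_addr _ _); exact: leq_sqr.
exists [ffun u => (x u < 0, Ordinal (kb u))] => [|u].
  by rewrite /in_net; under eq_bigr do rewrite ffunE; exact: ksum.
rewrite /net_point ffunE /=; move: (k_le u) (k_gt u) (k2 u).
move: (k u) => m; rewrite natrX => h1 h2 h3.
split; first by rewrite 2!exprMn sqrr_sign mul1r; lra.
have -> : 16^-1 = (4^-1) ^+ 2 :> R by field.
rewrite -[leLHS]real_normK ?num_real // lerXn2r ?nnegrE //.
move: h1 h2; rewrite normrM ger0_norm //.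
have [x0|x0] := ltP (x u) 0.
  rewrite ltr0_norm // expr1 => h1 h2; rewrite ler_norml; apply/andP; split; lra.
rewrite ger0_norm // expr0 => h1 h2; rewrite ler_norml; apply/andP; split; lra.
Qed.

Section NetBound.
Variable beta : R.
Hypothesis beta_gt0 : 0 < beta.
Hypothesis beta_net : forall z, in_net z ->
  `|bform (net_point z) (net_point z)| <= beta * n%:R.

(** Rounding x to a point y of the net, B(x, x) = B(y, y) + B(x - y, x + y),
    and the last term is at most half of the bound already known because x - y is
    small. *)
Lemma net_bound_step (L : R) : 0 <= L ->
  (forall x, `|bform x x| <= L * norm2 x) ->
  forall x, `|bform x x| <= (beta + L / 2) * norm2 x.
Proof.
move=> L0 hL x.
have [x0|x0] := eqVneq (norm2 x) 0; first by have := hL x; rewrite x0 !mulr0.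
have xp : 0 < norm2 x by rewrite lt_neqAle eq_sym x0 norm2_ge0.
have [n0|n0] := posnP n.
  by move: xp; rewrite /norm2 big1 ?ltxx // => -[m mn] _; exfalso; move: mn; rewrite n0.
have nr0 : 0 < n%:R :> R by rewrite ltr0n.
pose r := Num.sqrt (n%:R / norm2 x).
have r2 : r ^+ 2 = n%:R / norm2 x by rewrite sqr_sqrtr // divr_ge0 // ltW.
pose x' u := r * x u.
have x'n : norm2 x' = n%:R by rewrite norm2Z r2 divfK.
have [z zn zx] := net_approx x'n.
set y := net_point z in zx.
pose p u := x' u + -1 * y u; pose s u := x' u + 1 * y u.
have pn : norm2 p <= n%:R / 16.
  rewrite /norm2; apply: (@le_trans _ _ (\sum_(u < n) 16^-1)).
    by apply: ler_sum => u _; have [_] := zx u; rewrite /p mulN1r.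
  by rewrite sumr_const card_ord -[leLHS]mulr_natl.
have yn : norm2 y <= n%:R by rewrite -x'n; apply: ler_sum => u _; have [] := zx u.
have sn : norm2 s <= 4 * n%:R.
  apply: (@le_trans _ _ (2 * (norm2 x' + norm2 y))); last by rewrite x'n; lra.
  rewrite /norm2 -big_split mulr_sumr; apply: ler_sum => u _; rewrite /s /=.
  by have := sqr_ge0 (x' u - y u); rewrite !expr2; lra.
have e : bform x' x' = bform y y + bform p s.
  rewrite /p /s !(bformDl, bformDr).
  have Z a q t : bform (fun u => a * q u) t = a * bform q t.
    rewrite -[RHS]mulr1 -mulrA [_ * 1]mulrC mulrA -[a * 1]/(a * 1) -bformZ.
    by apply: eq_bigr => ? _; apply: eq_bigr => ? _; rewrite mul1r.
  have Z' b q t : bform t (fun u => b * q u) = b * bform q t.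
    by rewrite bformC Z.
  by rewrite !Z !Z' (bformC y x); ring.
have h : `|bform x' x'| <= (beta + L / 2) * n%:R.
  rewrite e; apply: le_trans (ler_normD _ _) _; rewrite mulrDl lerD ?beta_net //.
  apply: le_trans (bform_polar_le p s L0 hL) _.
  by rewrite ler_wpM2l ?divr_ge0 //; lra.
move: h; rewrite /x' bformZ -expr2 r2 normrM ger0_norm ?divr_ge0 ?(ltW xp) //.
by rewrite mulrAC ler_pdivrMr // [leLHS]mulrC [leRHS]mulrAC ler_pM2r.
Qed.

(** Iterating [net_bound_step] from any bound converges to 2 beta; the constant 3
    leaves room to stop after finitely many steps. *)
Lemma net_bound x : `|bform x x| <= 3 * beta * norm2 x.
Proof.
set L0 := \sum_u \sum_v `|B u v|.
have L00 : 0 <= L0 by rewrite sumr_ge0 // => u _; rewrite sumr_ge0.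
have it k y : `|bform y y| <= (2 * beta + L0 / 2 ^+ k) * norm2 y.
  elim: k y => [|k IH] y.
    apply: le_trans (bform_trivial_bound y) _; rewrite ler_wpM2r ?norm2_ge0 //.
    by rewrite expr0 divr1 -/L0; have := beta_gt0; lra.
  have P0 : 0 <= 2 * beta + L0 / 2 ^+ k.
    by rewrite addr_ge0 ?mulr_ge0 ?(ltW beta_gt0) // invr_ge0 exprn_ge0.
  apply: le_trans (net_bound_step P0 IH y) _; rewrite ler_wpM2r ?norm2_ge0 //.
  rewrite exprS invfM; lra.
pose k := (Num.truncn (L0 / beta)).+1.
apply: le_trans (it k x) _; rewrite ler_wpM2r ?norm2_ge0 //.
suff : L0 / 2 ^+ k <= beta by have := beta_gt0; lra.
rewrite ler_pdivrMr ?exprn_gt0 // mulrC -ler_pdivrMr //.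
have /andP[_ /ltW h] := truncn_itv (divr_ge0 L00 (ltW beta_gt0)).
by apply: le_trans h _; rewrite -natrX ler_nat ltnW // ltn_expl.
Qed.

End NetBound.

(** If a coordinate of absolute value k / 4 is given weight 2^-k, the total
    weight of all codes factors over the coordinates and is at most 4^n, whereas
    each point of the net has weight at least 2^-(16 n). *)
Lemma card_net : #|[set z | in_net z]|%:R <= (2 ^+ 18) ^+ n :> R.
Proof.
pose F (t : bool * 'I_(16 * n).+1) : R := 2^-1 ^+ t.2.
have F0 t : 0 <= F t by rewrite exprn_ge0 // invr_ge0.
have tot : \sum_(z : net) \prod_u F (z u) <= 4 ^+ n.
  rewrite -(bigA_distr_bigA (fun _ => F)) /= prodr_const card_ord.
  rewrite lerXn2r ?nnegrE ?sumr_ge0 // .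
  rewrite -(pair_bigA _ (fun (b : bool) (k : 'I_(16 * n).+1) => 2^-1 ^+ k)) /=.
  rewrite big_bool /= big_ord_recl expr0; have := sum_half_le1 R (16 * n); lra.
have low (z : net) : in_net z -> 2^-1 ^+ (16 * n) <= \prod_u F (z u).
  move=> zn; rewrite /F prodrXr ler_wiXn2l ?invr_ge0 ?invf_le1 ?ler1n //.
  by apply: leq_trans zn; apply: leq_sum => u _; exact: leq_sqr.
have : #|[set z | in_net z]|%:R * 2^-1 ^+ (16 * n) <= 4 ^+ n :> R.
  apply: le_trans tot; rewrite mulr_natl -sumr_const.
  rewrite [leRHS](bigID in_net) /= -[leLHS]addr0 lerD ?sumr_ge0 //.
    under eq_bigl do rewrite inE.
    by apply: ler_sum => z zn; exact: low.
  by move=> z _; rewrite prodr_ge0.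
rewrite exprVn ler_pdivrMr ?exprn_gt0 // => h; apply: le_trans h _.
have -> : 2 ^+ 18 = 4 * 2 ^+ 16 :> R by rewrite (exprD 2 2 16); congr (_ * _); ring.
by rewrite [2 ^+ (16 * n)]exprM [leRHS]exprMn.
Qed.

End QuadraticForms.

(** * Light pairs of a vector *)

Section OneVector.
Variables (R : realType) (K : nat) (H : frame R K).
Variables (n : nat) (c : {ffun 'I_n -> 'I_K}).
Hypothesis cs : class_sizes H c.
Variables (Delta pmin : R).
Hypothesis Delta_ge : forall i, \sum_j (degree H i j)%:R <= Delta.
Hypothesis Delta_gt0 : 0 < Delta.
Hypothesis pmin_gt0 : 0 < pmin.
Hypothesis pmin_le : forall i, pmin <= weight H i.
Hypothesis n_pos : (0 < n)%N.
Variables (y : 'I_n -> R) (tau : R).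
Hypothesis y_norm : norm2 y <= n%:R.
Hypothesis tau_ge : pmin^-1 <= tau.
Implicit Types (G : 'M[bool]_n) (T : {set 'I_n}) (u v : 'I_n).

Notation Om := (frame_graphs H c).
Notation q := (edge_density H n).

Definition light u v : bool := `|y u * y v| <= tau.
Definition light_weight u v : R := if light u v then y u * y v else 0.
Definition heavy_weight u v : R := if light u v then 0 else y u * y v.

Let n0 : 0 < n%:R :> R. Proof. by rewrite ltr0n. Qed.
Let tau0 : 0 < tau. Proof. by apply: lt_le_trans tau_ge; rewrite invr_gt0. Qed.

Lemma light_weightC u v : light_weight u v = light_weight v u.
Proof. by rewrite /light_weight /light mulrC. Qed.

Lemma light_weight_le u v : `|light_weight u v| <= tau.
Proof. by rewrite /light_weight; case: ifP => // _; rewrite normr0 ltW. Qed.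

Lemma light_weight_sqr_le u v : light_weight u v ^+ 2 <= tau * `|y u * y v|.
Proof.
rewrite /light_weight; case: ifP => [l|_]; last by rewrite expr0n mulr_ge0 // ltW.
by rewrite -real_normK ?num_real // expr2 ler_wpM2r.
Qed.

Lemma sum_edges_norm2 G : G \in Om -> \sum_u \sum_v y u ^+ 2 * (G u v)%:R <= Delta * n%:R.
Proof.
move=> GO; have h := sum_edges_le Delta_ge GO (fun u => sqr_ge0 (y u)).
by apply: le_trans h _; rewrite ler_pM2l.
Qed.

Lemma sum_edges_norm2' G : G \in Om -> \sum_u \sum_v y v ^+ 2 * (G u v)%:R <= Delta * n%:R.
Proof.
move=> GO; rewrite exchange_big /=.
under eq_bigr do under eq_bigr do rewrite (simple_graphC _ _ (frame_graph_simple GO)).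
exact: sum_edges_norm2.
Qed.

Lemma sum_light_sqr_edges G : G \in Om ->
  \sum_u \sum_v light_weight u v ^+ 2 * (G u v)%:R <= tau * Delta * n%:R.
Proof.
move=> GO; have h1 := sum_edges_norm2 GO; have h2 := sum_edges_norm2' GO.
apply: (@le_trans _ _ (tau * (2^-1 * ((\sum_u \sum_v y u ^+ 2 * (G u v)%:R)
    + (\sum_u \sum_v y v ^+ 2 * (G u v)%:R))))); last first.
  by rewrite -mulrA ler_pM2l //; lra.
rewrite -big_split !mulr_sumr; apply: ler_sum => u _.
rewrite -big_split !mulr_sumr; apply: ler_sum => v _ /=.
rewrite -mulrDl !mulrA ler_wpM2r //.
apply: le_trans (light_weight_sqr_le u v) _; rewrite -mulrA ler_pM2l //.
rewrite ler_norml; have := sqr_ge0 (y u - y v); have := sqr_ge0 (y u + y v).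
by rewrite sqrrD sqrrB => ? ?; apply/andP; split; lra.
Qed.

Lemma sum_sqr_density_le (z : 'I_n -> 'I_n -> R) (A : R) : 0 <= A ->
  (forall u v, z u v <= A * (y u ^+ 2 * y v ^+ 2)) ->
  \sum_u \sum_v z u v * q (c u) (c v) <= A * (Delta * n%:R / pmin).
Proof.
move=> A0 zA.
apply: (@le_trans _ _ (\sum_u \sum_v A * (Delta / (pmin * n%:R)) * (y u ^+ 2 * y v ^+ 2))).
  apply: ler_sum => u _; apply: ler_sum => v _.
  have q0 : 0 <= q (c u) (c v) by exact: edge_density_ge0.
  apply: le_trans (ler_wpM2r q0 (zA u v)) _; rewrite mulrAC.
  apply: ler_wpM2r; first by rewrite mulr_ge0 ?sqr_ge0.
  apply: ler_wpM2l => //; exact: (edge_density_le Delta_ge pmin_gt0 pmin_le u).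
under eq_bigr do rewrite -mulr_sumr -mulr_sumr mulrA.
rewrite -mulr_suml -/(norm2 y) -mulr_sumr -/(norm2 y).
apply: (@le_trans _ _ (A * (Delta / (pmin * n%:R)) * n%:R * n%:R)).
  have a0 : 0 <= A * (Delta / (pmin * n%:R)).
    by rewrite mulr_ge0 // divr_ge0 ?mulr_ge0 // ltW.
  apply: ler_pM; rewrite ?norm2_ge0 //.
    by apply: mulr_ge0; rewrite ?norm2_ge0.
  exact: ler_wpM2l.
by rewrite le_eqVlt; apply/orP; left; apply/eqP; field; rewrite !gt_eqF.
Qed.

Lemma sum_light_sqr_density :
  \sum_u \sum_v light_weight u v ^+ 2 * q (c u) (c v) <= tau * Delta * n%:R.
Proof.
apply: (@le_trans _ _ (1 * (Delta * n%:R / pmin))).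
  apply: sum_sqr_density_le => // u v; rewrite mul1r -exprMn /light_weight.
  by case: ifP => _; rewrite ?expr0n ?sqr_ge0.
by rewrite mul1r mulrC -mulrA ler_wpM2r // mulr_ge0 // ltW.
Qed.

(** The variance is of order tau Delta n rather than n^2 because
    (y_u y_v)^2 <= tau |y_u y_v| on light pairs, while the bounded degrees limit
    the sum of |y_u y_v| over the edges of any G. *)
Lemma light_tail_count (t : R) : 0 < t ->
  4 * tau * (Delta * (Delta + 1) / pmin) <= t / 2 ->
  #|[set G in Om | t <= `|edge_sum light_weight G - edge_mean H c light_weight|]|%:R <=
  #|Om|%:R * (2 * expR (- (t ^+ 2 / (128 * (tau * Delta * n%:R))))).
Proof.
move=> t0 tb; set V := tau * Delta * n%:R.
have V0 : 0 < V by rewrite !mulr_gt0.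
have one (w : 'I_n -> 'I_n -> R) : (forall u v, w u v = w v u) ->
    (forall u v, `|w u v| <= tau) ->
    (forall G, G \in Om -> \sum_u \sum_v w u v ^+ 2 * (G u v)%:R <= V) ->
    \sum_u \sum_v w u v ^+ 2 * q (c u) (c v) <= V ->
    #|[set G in Om | t <= edge_sum w G - edge_mean H c w]|%:R <=
    #|Om|%:R * expR (- (t ^+ 2 / (128 * V))).
  move=> wC wt wV wq.
  have -> : 128 * V = 16 * (8 * V) by rewrite mulrA -natrM.
  apply: (@tail_count_le _ _ _ (fun G => edge_sum w G - edge_mean H c w) (8 * V)
    (4 * tau * (Delta * (Delta + 1) / pmin))) => //; last by rewrite mulr_gt0.
  move=> th th0.
  have -> : 2 * (8 * V) * th = 16 * V * th by ring.
  exact: (exp_moment_derive_le cs Delta_ge pmin_gt0 pmin_le (Ordinal n_pos) wC wt wV wq).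
have pos := one light_weight light_weightC light_weight_le sum_light_sqr_edges sum_light_sqr_density.
have neg : #|[set G in Om | t <= - (edge_sum light_weight G - edge_mean H c light_weight)]|%:R
    <= #|Om|%:R * expR (- (t ^+ 2 / (128 * V))).
  pose w' u v := - light_weight u v.
  have E G : - (edge_sum light_weight G - edge_mean H c light_weight) =
      edge_sum w' G - edge_mean H c w'.
    rewrite /edge_sum /edge_mean opprB addrC -!sumrN; congr (_ + _).
      by apply: eq_bigr => u _; rewrite -sumrN; apply: eq_bigr => v _; rewrite mulNr.
    apply: eq_bigr => u _.
    by rewrite -sumrN; apply: eq_bigr => v _; rewrite mulNr opprK.
  have -> : [set G in Om | t <= - (edge_sum light_weight G - edge_mean H c light_weight)]
      = [set G in Om | t <= edge_sum w' G - edge_mean H c w'].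
    by apply/finset.setP => G; rewrite !finset.in_set E.
  apply: (one w').
  - by move=> u v; rewrite /w' light_weightC.
  - by move=> u v; rewrite normrN light_weight_le.
  - move=> G GO; under eq_bigr do under eq_bigr do rewrite sqrrN.
    exact: sum_light_sqr_edges.
  - under eq_bigr do under eq_bigr do rewrite sqrrN.
    exact: sum_light_sqr_density.
rewrite mulrCA mulr2n mulrDl mul1r; apply: le_trans (lerD pos neg).
rewrite -natrD ler_nat; apply: leq_trans (leq_card_setU _ _).
apply: subset_leq_card; apply/fintype.subsetP => G.
by rewrite finset.in_setU !finset.in_set ler_normr => /andP[-> /orP[] ->]; rewrite ?orbT.
Qed.

End OneVector.

(** * Heavy pairs of a vector in a locally sparse graph *)

Section SparseForm.
Variables (R : realType) (n alpha : nat) (G : 'M[bool]_n) (y : 'I_n -> R).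
Hypothesis sG : simple_graph G.
Implicit Types (T : {set 'I_n}) (u v : 'I_n).

Let deg T u : R := \sum_(v in T) (G u v)%:R.

Lemma sum_degrees_in T : \sum_(u in T) deg T u = 2 * #|edges_in G T|%:R.
Proof.
have half : \sum_(u in T) \sum_(v in T) ((u < v)%N && G u v)%:R = #|edges_in G T|%:R :> R.
  rewrite pair_big_dep /= -sum1_card natr_sum.
  rewrite big_mkcond [RHS]big_mkcond; apply: eq_bigr => -[u v] _ /=.
  rewrite !inE /=; case: (u \in T); case: (v \in T); case: (u < v)%N; case: (G u v) => //=.
have half' : \sum_(u in T) \sum_(v in T) ((v < u)%N && G u v)%:R = #|edges_in G T|%:R :> R.
  rewrite -half exchange_big; apply: eq_bigr => u _; apply: eq_bigr => v _ /=.
  by rewrite (simple_graphC v u sG).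
rewrite mulr_natl mulr2n -{1}half -half' -big_split.
apply: eq_bigr => u _; rewrite -big_split; apply: eq_bigr => v _ /=.
case: (ltngtP u v) => [_|_|/val_inj ->] /=; rewrite ?addr0 ?add0r //.
by rewrite (simple_graphxx _ sG).
Qed.

(** T contains a vertex a with at most 2 alpha neighbours in T, which is removed.
    The terms at a are bounded by 2 |y_a y_v| <= gam y_a^2 + y_v^2 / gam: along
    the induction each vertex pays the price gam for at most 2 alpha edges and
    the price 1 / gam for the others. *)
Lemma sparse_form_le (gam : R) T : 0 < gam ->
  (forall T', T' \subset T -> (#|edges_in G T'| <= alpha * #|T'|)%N) ->
  \sum_(u in T) \sum_(v in T) (G u v)%:R * `|y u * y v| <=
  \sum_(u in T) y u ^+ 2 * (2 * alpha%:R * gam + deg T u / gam).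
Proof.
move=> g0; move: {2}#|T| (erefl #|T|) => m.
elim: m T => [|m IH] T Tm sparse.
  by have /eqP := Tm; rewrite cards_eq0 => /eqP ->; rewrite !big_set0.
have [a aT da] : exists2 a, a \in T & deg T a <= 2 * alpha%:R.
  have [/existsP[a /andP[aT da]]|] := boolP [exists a, (a \in T) && (deg T a <= 2 * alpha%:R)].
    by exists a.
  rewrite negb_exists => /forallP h; exfalso.
  have : \sum_(u in T) (2 * alpha%:R) < \sum_(u in T) deg T u.
    apply: ltr_sum.
      have : (0 < #|T|)%N by rewrite Tm.
      by move=> /card_gt0P[x xT]; apply/hasP; exists x; rewrite ?mem_index_enum.
    by move=> u uT; have := h u; rewrite uT /= -ltNge.
  rewrite sum_degrees_in sumr_const -[_ *+ _]mulr_natr -mulrA ltr_pM2l // -natrM ltr_nat.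
  by rewrite ltnNge sparse.
pose T' := T :\ a.
have T'm : #|T'| = m by apply/eqP; rewrite -eqSS -Tm (cardsD1 a T) aT.
have {}IH := IH T' T'm (fun U UT => sparse U (fintype.subset_trans UT (subD1set T a))).
have split1 (F : 'I_n -> R) : \sum_(u in T) F u = F a + \sum_(u in T') F u.
  by rewrite (big_setD1 a).
have split2 (F : 'I_n -> 'I_n -> R) : \sum_(u in T) \sum_(v in T) F u v =
   F a a + \sum_(v in T') F a v + \sum_(u in T') F u a + \sum_(u in T') \sum_(v in T') F u v.
  rewrite split1 split1 -!addrA; congr (_ + (_ + _)); rewrite -big_split.
  by apply: eq_bigr => u _; rewrite split1.
rewrite split2 (simple_graphxx _ sG) mul0r add0r.
have cross : \sum_(v in T') (G a v)%:R * `|y a * y v| + \sum_(u in T') (G u a)%:R * `|y u * y a|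
   <= gam * y a ^+ 2 * deg T a + \sum_(v in T') y v ^+ 2 * ((G v a)%:R / gam).
  rewrite -big_split /deg [X in gam * _ * X]split1 (simple_graphxx _ sG) add0r mulr_sumr -big_split.
  apply: ler_sum => v _ /=; rewrite [y v * y a]mulrC (simple_graphC v a sG).
  rewrite -mulrDr [X in _ <= X + _]mulrC [y v ^+ 2 * _]mulrCA -mulrDr ler_wpM2l //.
  have -> : gam * y a ^+ 2 + y v ^+ 2 / gam = (gam * `|y a| - `|y v|) ^+ 2 / gam + 2 * `|y a * y v|.
    rewrite -(real_normK (num_real (y a))) -(real_normK (num_real (y v))) normrM.
    by field; rewrite gt_eqF.
  have : 0 <= (gam * `|y a| - `|y v|) ^+ 2 / gam by rewrite divr_ge0 ?sqr_ge0 // ltW.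
  by lra.
apply: le_trans (lerD cross IH) _; rewrite -addrA -big_split /= [leRHS]split1 lerD //.
  rewrite -mulrA [leLHS]mulrCA; apply: ler_wpM2l; first exact: sqr_ge0.
  have : 0 <= deg T a / gam by rewrite divr_ge0 ?sumr_ge0 // ltW.
  have : gam * deg T a <= gam * (2 * alpha%:R) by rewrite ler_wpM2l // ltW.
  by lra.
apply: ler_sum => v vT'.
have -> : deg T v = (G v a)%:R + deg T' v by rewrite /deg split1.
by rewrite le_eqVlt; apply/orP; left; apply/eqP; ring.
Qed.

End SparseForm.

Section HeavyPart.
Variables (R : realType) (K : nat) (H : frame R K).
Variables (n : nat) (c : {ffun 'I_n -> 'I_K}).
Variables (Delta pmin : R).
Hypothesis Delta_ge : forall i, \sum_j (degree H i j)%:R <= Delta.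
Hypothesis Delta_gt0 : 0 < Delta.
Hypothesis pmin_gt0 : 0 < pmin.
Hypothesis pmin_le : forall i, pmin <= weight H i.
Hypothesis n_pos : (0 < n)%N.
Variables (y : 'I_n -> R) (tau : R) (alpha : nat) (sigma eta gam : R).
Hypothesis y_norm : norm2 y <= n%:R.
Hypothesis tau_gt0 : 0 < tau.
Hypothesis eta_gt0 : 0 < eta.
Hypothesis gam_gt0 : 0 < gam.
Hypothesis sigmaE : 1 <= sigma * (eta * tau).
Variable G : 'M[bool]_n.
Hypothesis GO : G \in frame_graphs H c.
Hypothesis G_sparse : ~~ [exists T, dense_spot alpha sigma G T].

Notation q := (edge_density H n).

(** On heavy pairs |y_u y_v| <= y_u^2 y_v^2 / tau. *)
Lemma heavy_density_le :
  `|\sum_u \sum_v heavy_weight y tau u v * q (c u) (c v)| <= Delta * n%:R / (pmin * tau).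
Proof.
apply: (@le_trans _ _ (\sum_u \sum_v `|heavy_weight y tau u v| * q (c u) (c v))).
  apply: le_trans (ler_norm_sum _ _ _) _; apply: ler_sum => u _.
  apply: le_trans (ler_norm_sum _ _ _) _; apply: ler_sum => v _.
  by rewrite normrM [`|q _ _|]ger0_norm // edge_density_ge0.
have -> : Delta * n%:R / (pmin * tau) = tau^-1 * (Delta * n%:R / pmin).
  by field; rewrite !gt_eqF.
apply: (sum_sqr_density_le c Delta_ge Delta_gt0 pmin_gt0 pmin_le n_pos y_norm (z := fun u v => `|heavy_weight y tau u v|)).
  by rewrite invr_ge0 ltW.
move=> u v; rewrite /heavy_weight /light; case: (leP `|y u * y v| tau) => [_|h].
  by rewrite normr0 mulr_ge0 ?invr_ge0 ?(ltW tau_gt0) // mulr_ge0 ?sqr_ge0.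
rewrite ler_pdivlMl // -exprMn -(real_normK (num_real (y u * y v))) expr2.
by rewrite ler_wpM2r // ltW.
Qed.

(** If |y_v| <= eta |y_u|, the term is at most eta y_u^2; likewise with u and v
    exchanged.  In the other heavy pairs both coordinates have squares above
    eta tau, so both vertices lie in a set of at most sigma n vertices, where
    [sparse_form_le] applies. *)
Lemma heavy_edges_le :
  `|\sum_u \sum_v heavy_weight y tau u v * (G u v)%:R| <=
  (2 * eta * Delta + (2 * alpha%:R * gam + Delta / gam)) * n%:R.
Proof.
have sG := frame_graph_simple GO.
pose S := [set u | eta * tau < y u ^+ 2].
have et0 : 0 < eta * tau by rewrite mulr_gt0.
have Ssize : #|S|%:R <= sigma * n%:R.
  rewrite -(ler_pM2r et0) mulr_natl -sumr_const.
  apply: (@le_trans _ _ (norm2 y)).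
    rewrite /norm2 big_mkcond; apply: ler_sum => u _.
    by case: ifP => [|_]; rewrite ?sqr_ge0 // finset.in_set => /ltW.
  apply: le_trans y_norm _; rewrite mulrAC -[leLHS]mul1r ler_wpM2r //.
have sparse (T' : {set 'I_n}) : T' \subset S -> (#|edges_in G T'| <= alpha * #|T'|)%N.
  move=> T'S; have [->|T0] := eqVneq T' finset.set0.
    rewrite cards0 muln0 leqn0 cards_eq0; apply/eqP/finset.setP => p.
    by rewrite !inE /= andbF.
  move: G_sparse; rewrite negb_exists => /forallP/(_ T').
  rewrite /dense_spot card_gt0 T0 /= negb_and -leqNgt => /orP[|//].
  rewrite (le_trans _ Ssize) // ler_nat; exact: subset_leq_card.
have h3 := sparse_form_le y sG gam_gt0 sparse.
have h1 := sum_edges_norm2 Delta_ge Delta_gt0 y_norm GO.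
have h2 := sum_edges_norm2' Delta_ge Delta_gt0 y_norm GO.
have h4 : \sum_(u in S) y u ^+ 2 * (2 * alpha%:R * gam + (\sum_(v in S) (G u v)%:R) / gam) <=
    (2 * alpha%:R * gam + Delta / gam) * n%:R.
  have k0 : 0 <= 2 * alpha%:R * gam + Delta / gam.
    by rewrite addr_ge0 ?divr_ge0 ?mulr_ge0 // ltW.
  apply: le_trans (ler_wpM2l k0 y_norm); rewrite /norm2 mulr_sumr big_mkcond /=.
  apply: ler_sum => u _; case: ifP => _; last by rewrite mulr_ge0 ?sqr_ge0.
  rewrite mulrC ler_wpM2r ?sqr_ge0 // lerD2l ler_wpM2r ?invr_ge0 ?(ltW gam_gt0) //.
  apply: le_trans (total_degree_le Delta_ge u GO).
  by rewrite big_mkcond; apply: ler_sum => v _; case: ifP.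
apply: (@le_trans _ _ (eta * (\sum_u \sum_v y u ^+ 2 * (G u v)%:R)
   + eta * (\sum_u \sum_v y v ^+ 2 * (G u v)%:R)
   + \sum_(u in S) \sum_(v in S) (G u v)%:R * `|y u * y v|)); last first.
  apply: le_trans (lerD (lerD (ler_wpM2l (ltW eta_gt0) h1) (ler_wpM2l (ltW eta_gt0) h2))
    (le_trans h3 h4)) _.
  by rewrite le_eqVlt; apply/orP; left; apply/eqP; ring.
apply: le_trans (ler_norm_sum _ _ _) _.
rewrite [X in _ + X]big_mkcond /= !mulr_sumr -!big_split; apply: ler_sum => u _ /=.
apply: le_trans (ler_norm_sum _ _ _) _.
have -> : (if u \in S then \sum_(v in S) (G u v)%:R * `|y u * y v| else 0) =
   \sum_v (if (u \in S) && (v \in S) then (G u v)%:R * `|y u * y v| else 0).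
  by case: ifP => _; [rewrite big_mkcond | rewrite big1].
rewrite !mulr_sumr -!big_split; apply: ler_sum => v _ /=.
rewrite normrM normr_nat.
case: (G u v); last by rewrite !mulr0 !add0r; case: ifP => // _; rewrite mul0r.
rewrite !mulr1 mul1r.
have p1 : 0 <= eta * y u ^+ 2 by rewrite mulr_ge0 ?sqr_ge0 // ltW.
have p2 : 0 <= eta * y v ^+ 2 by rewrite mulr_ge0 ?sqr_ge0 // ltW.
rewrite /heavy_weight /light; case: (leP `|y u * y v| tau) => [_|hv].
  by rewrite normr0 addr_ge0 ?addr_ge0 //; case: ifP.
have mem (s t : 'I_n) : tau < `|y s * y t| -> eta * `|y s| < `|y t| -> t \in S.
  move=> h hst; rewrite finset.in_set -(real_normK (num_real (y t))) expr2.
  apply: (@lt_le_trans _ _ (eta * `|y s * y t|)); first by rewrite ltr_pM2l.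
  by rewrite normrM mulrA ler_wpM2r // ltW.
have [uv|uv] := leP `|y v| (eta * `|y u|).
  have : `|y u * y v| <= eta * y u ^+ 2.
    by rewrite normrM -(real_normK (num_real (y u))) expr2 mulrA mulrC ler_wpM2r.
  by case: ifP => _; move: (normr_ge0 (y u * y v)); lra.
have [vu|vu] := leP `|y u| (eta * `|y v|).
  have : `|y u * y v| <= eta * y v ^+ 2.
    by rewrite normrM -(real_normK (num_real (y v))) expr2 mulrA ler_wpM2r.
  by case: ifP => _; move: (normr_ge0 (y u * y v)); lra.
rewrite (mem u v) // (mem v u) ?[y v * _]mulrC //=.
by lra.
Qed.

Lemma centered_form_le (t : R) :
  `|edge_sum (light_weight y tau) G - edge_mean H c (light_weight y tau)| <= t ->
  `|bform (fun u v => (G u v)%:R - q (c u) (c v)) y y| <=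
  t + Delta * n%:R / (pmin * tau)
  + (2 * eta * Delta + (2 * alpha%:R * gam + Delta / gam)) * n%:R.
Proof.
have hd := heavy_density_le; have he := heavy_edges_le => lt.
have -> : bform (fun u v => (G u v)%:R - q (c u) (c v)) y y =
   (edge_sum (light_weight y tau) G - edge_mean H c (light_weight y tau))
   - (\sum_u \sum_v heavy_weight y tau u v * q (c u) (c v))
   + \sum_u \sum_v heavy_weight y tau u v * (G u v)%:R.
  rewrite /edge_sum /edge_mean -!sumrN -!big_split; apply: eq_bigr => u _.
  rewrite /= -!sumrN -!big_split; apply: eq_bigr => v _.
  by rewrite /light_weight /heavy_weight; case: ifP => _ /=; ring.
apply: le_trans (ler_normD _ _) _; apply: lerD => //.
by apply: le_trans (ler_normB _ _) _; apply: lerD.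
Qed.

End HeavyPart.

(** * Typical graphs *)

Section TypicalGraphs.
Variables (R : realType) (K : nat) (H : frame R K).
Variables (n : nat) (c : {ffun 'I_n -> 'I_K}).
Hypothesis cs : class_sizes H c.
Variables (Delta pmin : R).
Hypothesis Delta_ge : forall i, \sum_j (degree H i j)%:R <= Delta.
Hypothesis Delta_gt0 : 0 < Delta.
Hypothesis pmin_gt0 : 0 < pmin.
Hypothesis pmin_le : forall i, pmin <= weight H i.
Hypothesis n_pos : (0 < n)%N.
Variables (tau t : R) (alpha : nat) (sigma : R).

Notation Om := (frame_graphs H c).

Definition centered_adjacency (G : 'M[bool]_n) (u v : 'I_n) : R :=
  (G u v)%:R - edge_density H n (c u) (c v).

Definition atypical_graphs : {set 'M[bool]_n} :=
  [set G in Om | [exists T, dense_spot alpha sigma G T] ||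
     [exists z, in_net z &&
        (t <= `|edge_sum (light_weight (@net_point R n z) tau) G
                - edge_mean H c (light_weight (@net_point R n z) tau)|)]].

Lemma card_atypical_le (B : R) : pmin^-1 <= tau -> 0 < t ->
  4 * tau * (Delta * (Delta + 1) / pmin) <= t / 2 -> (2 < alpha)%N ->
  (forall i j, degree H i j != 0%N ->
     2 * Delta * (Delta + 1) + 2 * (alpha%:R * (sigma * n%:R)) <= edge_count H n i j / 2) ->
  B = 8 * Delta / (pmin * alpha%:R) -> B * sigma <= 1 -> 16 * B ^+ 2 * sigma <= 1 ->
  #|atypical_graphs|%:R <= #|Om|%:R *
    (B / n%:R + (2 ^+ 18) ^+ n * (2 * expR (- (t ^+ 2 / (128 * (tau * Delta * n%:R)))))).
Proof.
move=> tau_ge t0 tb a3 Mge BE Bs1 Bs2; set e := expR _.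
pose far z : {set 'M[bool]_n} := [set G in Om |
   (t <= `|edge_sum (light_weight (@net_point R n z) tau) G
                - edge_mean H c (light_weight (@net_point R n z) tau)|)].
have dense := card_dense_graphs cs Delta_ge Delta_gt0 pmin_gt0 pmin_le n_pos a3 Mge BE Bs1 Bs2.
have far_le z : in_net z -> #|far z|%:R <= #|Om|%:R * (2 * e).
  move=> zn; apply: (light_tail_count cs Delta_ge Delta_gt0 pmin_gt0 pmin_le n_pos) => //.
  exact: norm2_net_point.
have farsum : \sum_(z in [set z | in_net z]) #|far z|%:R <=
    #|Om|%:R * ((2 ^+ 18) ^+ n * (2 * e)).
  apply: (@le_trans _ _ (\sum_(z in [set z | in_net z]) #|Om|%:R * (2 * e))).
    by apply: ler_sum => z; rewrite finset.in_set => /far_le.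
  rewrite sumr_const -[leLHS]mulr_natl mulrCA ler_wpM2l // ler_wpM2r //.
    by rewrite mulr_ge0 // expR_ge0.
  exact: card_net.
rewrite mulrDr; apply: le_trans (lerD dense farsum).
rewrite -natr_sum -natrD ler_nat.
have cup : (#|\bigcup_(z in [set z | @in_net n z]) far z| <=
    \sum_(z in [set z | in_net z]) #|far z|)%N.
  elim/big_rec2: _ => [|z N U _ NU]; first by rewrite cards0.
  by apply: leq_trans (leq_card_setU _ _) _; rewrite leq_add2l.
apply: leq_trans (leq_add (leqnn _) cup); apply: leq_trans (leq_card_setU _ _).
apply: subset_leq_card; apply/fintype.subsetP => G.
rewrite finset.in_set => /andP[GO /orP[d|/existsP[z /andP[zn zt]]]].
  by rewrite finset.in_setU finset.in_set GO d.
rewrite finset.in_setU; apply/orP; right; apply/finset.bigcupP; exists z.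
  by rewrite finset.in_set.
by rewrite finset.in_set GO zt.
Qed.

Lemma typical_form_le (eta gam beta : R) :
  0 < tau -> 0 < eta -> 0 < gam -> 1 <= sigma * (eta * tau) -> 0 < beta ->
  t + Delta * n%:R / (pmin * tau)
  + (2 * eta * Delta + (2 * alpha%:R * gam + Delta / gam)) * n%:R <= beta * n%:R ->
  forall G, G \in Om -> G \notin atypical_graphs ->
  forall x, `|bform (centered_adjacency G) x x| <= 3 * beta * norm2 x.
Proof.
move=> tau0 eta0 gam0 sE b0 bound G GO.
rewrite finset.in_set GO /= negb_or => /andP[sparse]; rewrite negb_exists => /forallP close.
apply: net_bound => //.
  move=> u v; rewrite /centered_adjacency (simple_graphC u v (frame_graph_simple GO)).
  by rewrite edge_densityC.
move=> z zn; apply: le_trans bound.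
have := close z; rewrite zn /= -ltNge => /ltW zt.
exact: (centered_form_le Delta_ge Delta_gt0 pmin_gt0 pmin_le n_pos (norm2_net_point R zn) tau0
  eta0 gam0 sE GO sparse zt).
Qed.

End TypicalGraphs.

(** * The spectral gap *)

Ltac pos_prod := repeat first [done | apply: mulr_gt0 | apply: exprn_gt0].

Lemma exp_tail_le (R : realType) (n : nat) : (0 < n)%N ->
  (2 ^+ 18) ^+ n * (2 * expR (- (20 * n%:R))) <= n%:R^-1 :> R.
Proof.
move=> n0; have nr0 : 0 < n%:R :> R by rewrite ltr0n.
have e2 : 2 <= expR 1 :> R by have := expR_ge1Dx (1 : R); lra.
have h1 : (2 ^+ 18) ^+ n <= expR (18 * n%:R) :> R.
  rewrite -exprM -[18 * n%:R]mulr1 -natrM expRM_natl.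
  by rewrite lerXn2r ?nnegrE ?expR_ge0.
apply: (@le_trans _ _ (expR (18 * n%:R) * (2 * expR (- (20 * n%:R))))).
  by rewrite ler_wpM2r // mulr_ge0 // expR_ge0.
rewrite mulrCA -expRD (_ : 18 * n%:R - 20 * n%:R = - (2 * n%:R)); last by ring.
rewrite expRN ler_pdivrMr ?expR_gt0 // mulrC ler_pdivlMr //.
by have := expR_ge1Dx (2 * n%:R : R); lra.
Qed.

(** The constants.  All degrees are at most Delta = kappa d0.  Each of the four
    terms that bound the form on the net is made at most b0 kappa n, so that
    [net_bound] yields 12 b0 kappa = l kappa / 2.  For the light pairs this is
    the choice of t, and theta is such that the tail exponent
    t^2 / (128 tau Delta n) is 20 n; eta settles the unbalanced pairs; gam makes
    Delta / gam equal to b0 kappa / 2, and k1 makes 2 alpha gam at most that.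
    Everything else holds when alpha, hence kappa = k1 alpha, and then n are
    large, the numbers A1, ..., A5 and N1, N2 being the thresholds. *)
Lemma spectral_gap_whp (R : realType) (K : nat) (H : frame R K) (l : R) :
  (forall i : 'I_K, (0 < \sum_l degree H i l)%N) -> 0 < l ->
  exists kappa : nat, (0 < kappa)%N /\ exists (C : R) (n1 : nat),
    forall n (c : {ffun 'I_n -> 'I_K}), (n1 <= n)%N ->
      class_sizes (scale_frame H kappa) c ->
      exists2 Bad : {set 'M[bool]_n},
        #|Bad|%:R <= #|frame_graphs (scale_frame H kappa) c|%:R * (C / n%:R) &
        forall G, G \in frame_graphs (scale_frame H kappa) c -> G \notin Bad ->
        forall x, `|bform (centered_adjacency (scale_frame H kappa) c G) x x|
                  <= l * kappa%:R / 2 * norm2 x.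
Proof.
move=> row_gt0 l0.
have K0 : (0 < K)%N.
  by case: K H row_gt0 => // H _; have := weight_sum1 H; rewrite big_ord0 => /eqP; rewrite eq_sym oner_eq0.
pose i0 : 'I_K := Ordinal K0.
have w0 i : 0 < weight H i by exact: weight_gt0.
pose pmin : R := (\sum_i (weight H i)^-1)^-1.
have pmin_gt0 : 0 < pmin.
  rewrite invr_gt0 (bigD1 i0) //= ltr_pwDl ?invr_gt0 // sumr_ge0 // => i _.
  by rewrite invr_ge0 ltW.
have pmin_le i : pmin <= weight H i.
  rewrite -[leRHS]invrK lef_pV2 ?posrE ?invr_gt0 //; last first.
    by move: pmin_gt0; rewrite invr_gt0.
  by rewrite (bigD1 i) //= lerDl sumr_ge0 // => j _; rewrite invr_ge0 ltW.
pose d : nat := \sum_i \sum_j degree H i j.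
have row_le i : (\sum_j degree H i j <= d)%N by rewrite /d [X in (_ <= X)%N](bigD1 i) //= leq_addr.
have d_gt0 : (0 < d)%N by apply: leq_trans (row_gt0 i0) (row_le i0).
pose d0 : R := d%:R.
have d00 : 0 < d0 by rewrite ltr0n.
pose b0 : R := l / 24.
have b00 : 0 < b0 by rewrite divr_gt0.
pose eta := b0 / (2 * d0).
pose gam := 2 * d0 / b0.
pose theta := b0 ^+ 2 / (20 * (128 * d0)).
have eta0 : 0 < eta by rewrite divr_gt0 ?mulr_gt0.
have gam0 : 0 < gam by rewrite divr_gt0 ?mulr_gt0.
have theta0 : 0 < theta by rewrite divr_gt0 ?mulr_gt0 ?exprn_gt0.
have above (z : R) : z <= (Num.truncn `|z|).+1%:R.
  by apply: le_trans (ler_norm z) _; have /andP[_ /ltW] := truncn_itv (normr_ge0 z).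
pose k1 := (Num.truncn `|8 * d0 / b0 ^+ 2|).+1.
have k1_ge : 8 * d0 / b0 ^+ 2 <= k1%:R by exact: above.
have k10 : 0 < k1%:R :> R by rewrite ltr0n.
pose B := 8 * k1%:R * d0 / pmin.
have B0 : 0 < B by rewrite divr_gt0 ?mulr_gt0.
pose A1 := (pmin * theta)^-1.
pose A2 := d0 / (pmin * theta * b0).
pose A3 := B / (eta * theta).
pose A4 := 16 * B ^+ 2 / (eta * theta).
pose A5 := 8 / (pmin * eta * theta * k1%:R).
have A10 : 0 <= A1 by rewrite invr_ge0 mulr_ge0 // ltW.
have A20 : 0 <= A2 by rewrite /A2; apply: divr_ge0; apply: ltW; pos_prod.
have A30 : 0 <= A3 by rewrite /A3; apply: divr_ge0; apply: ltW; pos_prod.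
have A40 : 0 <= A4 by rewrite /A4; apply: divr_ge0; apply: ltW; pos_prod.
have A50 : 0 <= A5 by rewrite /A5; apply: divr_ge0; apply: ltW; pos_prod.
pose alpha := ((Num.truncn `|A1 + A2 + A3 + A4 + A5|%R).+1 + 2)%N.
pose kappa := (k1 * alpha)%N.
have a3 : (2 < alpha)%N by rewrite /alpha addn2.
have kr : kappa%:R = k1%:R * alpha%:R :> R by rewrite natrM.
have kA : A1 + A2 + A3 + A4 + A5 <= kappa%:R.
  apply: le_trans (above _) _; rewrite ler_nat.
  by apply: (@leq_trans alpha); [rewrite leq_addr | rewrite leq_pmull].
have ar0 : 0 < alpha%:R :> R by rewrite ltr0n (ltn_trans _ a3).
have kap0 : 0 < kappa%:R :> R by rewrite kr mulr_gt0.
have kapN : (0 < kappa)%N by rewrite -(ltr_nat R).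
exists kappa; split => //.
pose Delta : R := kappa%:R * d0.
have Delta_gt0 : 0 < Delta by rewrite mulr_gt0.
pose tau := theta * kappa%:R.
have tau0 : 0 < tau by rewrite mulr_gt0.
pose sigma := (eta * tau)^-1.
have sigma0 : 0 < sigma by rewrite invr_gt0 mulr_gt0.
pose N1 := 8 * tau * (Delta * (Delta + 1)) / (pmin * (b0 * kappa%:R)).
pose N2 := 8 * Delta * (Delta + 1) / (pmin * kappa%:R).
have D1 : 0 < Delta + 1 by rewrite addr_gt0.
have N10 : 0 <= N1.
  by rewrite /N1; apply: divr_ge0; apply: ltW; pos_prod.
have N20 : 0 <= N2.
  by rewrite /N2; apply: divr_ge0; apply: ltW; pos_prod.
exists (B + 1), (Num.truncn `|N1 + N2|).+1 => n c n1 cs.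
have n0 : (0 < n)%N by apply: leq_trans n1.
have nr0 : 0 < n%:R :> R by rewrite ltr0n.
have nN : N1 + N2 <= n%:R by apply: le_trans (above _) _; rewrite ler_nat.
set H' := scale_frame H kappa in cs *.
have degE i j : degree H' i j = (kappa * degree H i j)%N by rewrite mxE.
have Delta_ge i : \sum_j (degree H' i j)%:R <= Delta.
  under eq_bigr do rewrite degE natrM; rewrite -mulr_sumr ler_pM2l //.
  by rewrite -natr_sum ler_nat row_le.
pose t := b0 * kappa%:R * n%:R.
have t0 : 0 < t by rewrite !mulr_gt0.
exists (atypical_graphs H' c tau t alpha sigma).
  have BE : B = 8 * Delta / (pmin * alpha%:R).
    by rewrite /B /Delta kr; field; rewrite !gt_eqF.
  have sE : sigma = (eta * theta)^-1 / kappa%:R by rewrite /sigma /tau; field; rewrite !gt_eqF.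
  have Bs1 : B * sigma <= 1.
    by rewrite sE mulrA ler_pdivrMr // mul1r -/A3; lra.
  have Bs2 : 16 * B ^+ 2 * sigma <= 1.
    by rewrite sE mulrA ler_pdivrMr // mul1r -/A4; lra.
  have tau_ge : pmin^-1 <= tau.
    rewrite /tau -ler_pdivrMl // -invfM mulrC -/A1; lra.
  have tb : 4 * tau * (Delta * (Delta + 1) / pmin) <= t / 2.
    have h : N1 <= n%:R by lra.
    move: h; rewrite /N1 ler_pdivrMr ?mulr_gt0 // => h.
    rewrite mulrA ler_pdivrMr // /t; lra.
  have Mge i j : degree H' i j != 0%N ->
     2 * Delta * (Delta + 1) + 2 * (alpha%:R * (sigma * n%:R)) <= edge_count H' n i j / 2.
    move=> dn; have dij : (0 < degree H i j)%N.
      by move: dn; rewrite degE muln_eq0 negb_or lt0n => /andP[].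
    apply: (@le_trans _ _ (n%:R * pmin * kappa%:R / 2)); last first.
      rewrite ler_pM2r ?invr_gt0 // /edge_count degE -!mulrA ler_pM2l //.
      apply: ler_pM => //; [exact: ltW | exact: pmin_le | by rewrite ler_nat leq_pmulr].
    have h2 : N2 <= n%:R by lra.
    move: h2; rewrite /N2 ler_pdivrMr ?mulr_gt0 // => h2.
    have h5 : A5 <= kappa%:R by lra.
    have e5 : alpha%:R * sigma = pmin * A5 / 8.
      by rewrite sE /A5 kr; field; rewrite !gt_eqF.
    rewrite [alpha%:R * _]mulrA e5.
    have : pmin * A5 * n%:R <= pmin * kappa%:R * n%:R by rewrite ler_pM2r // ler_pM2l.
    lra.
  apply: le_trans (card_atypical_le cs Delta_ge Delta_gt0 pmin_gt0 pmin_le n0 tau_ge t0 tb a3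
    Mge BE Bs1 Bs2) _.
  apply: ler_wpM2l => //; rewrite [leRHS]mulrDl lerD2l mul1r.
  have -> : t ^+ 2 / (128 * (tau * Delta * n%:R)) = 20 * n%:R.
    by rewrite /t /tau /Delta /theta; field; rewrite !gt_eqF.
  exact: exp_tail_le.
have bnd : t + Delta * n%:R / (pmin * tau)
  + (2 * eta * Delta + (2 * alpha%:R * gam + Delta / gam)) * n%:R
  <= (4 * b0 * kappa%:R) * n%:R.
  have p1 : Delta * n%:R / (pmin * tau) <= b0 * kappa%:R * n%:R.
    have -> : Delta * n%:R / (pmin * tau) = b0 * A2 * n%:R.
      by rewrite /A2 /Delta /tau; field; rewrite !gt_eqF.
    rewrite ler_pM2r // ler_pM2l //; lra.
  have p2 : 2 * eta * Delta = b0 * kappa%:R.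
    by rewrite /eta /Delta; field; rewrite !gt_eqF.
  have p3 : Delta / gam = b0 * kappa%:R / 2.
    by rewrite /gam /Delta; field; rewrite !gt_eqF.
  have p4 : 2 * alpha%:R * gam <= b0 * kappa%:R / 2.
    have -> : 2 * alpha%:R * gam = (b0 * alpha%:R / 2) * (8 * d0 / b0 ^+ 2).
      by rewrite /gam; field; rewrite !gt_eqF.
    have -> : b0 * kappa%:R / 2 = (b0 * alpha%:R / 2) * k1%:R by rewrite kr; ring.
    by rewrite ler_pM2l // divr_gt0 ?mulr_gt0.
  rewrite p2 p3 /t.
  have : (2 * alpha%:R * gam) * n%:R <= b0 * kappa%:R / 2 * n%:R by rewrite ler_pM2r.
  lra.
have b40 : 0 < 4 * b0 * kappa%:R by rewrite !mulr_gt0.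
have sE : 1 <= sigma * (eta * tau).
  by rewrite /sigma mulVf // gt_eqF // mulr_gt0.
move=> G GO Gt x.
have := typical_form_le Delta_ge Delta_gt0 pmin_gt0 pmin_le n0 tau0 eta0 gam0 sE b40 bnd GO Gt x.
rewrite (_ : 3 * (4 * b0 * kappa%:R) = l * kappa%:R / 2) //.
by rewrite /b0; field.
Qed.

(** * Characteristic polynomials and invariant subspaces *)

Section CharPolyConj.
Variables (F : fieldType).

Lemma char_poly_intertwine n (A B Q : 'M[F]_n) :
  Q \in unitmx -> Q *m A = B *m Q -> char_poly A = char_poly B.
Proof.
move=> Qu QA; rewrite /char_poly.
have dQ : \det (map_mx polyC Q) != 0.
  by rewrite det_map_mx polyC_eq0 -unitfE -unitmxE.
apply: (mulfI dQ); rewrite -det_mulmx [RHS]mulrC -det_mulmx; congr (\det _).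
rewrite /char_poly_mx mulmxBr mulmxBl -!map_mxM QA; congr (_ - _).
by rewrite -scalar_mxC.
Qed.

(** In a basis that starts with a basis of the column space of L, the matrix P is
    block triangular and its first block is conjugate to M. *)
Lemma char_poly_dvd_block K m (P : 'M[F]_(K + m)) (L : 'M[F]_(K + m, K)) (M : 'M[F]_K) :
  \rank L = K -> P *m L = L *m M -> char_poly M %| char_poly P.
Proof.
move=> rL PL.
set U := col_ebase L; set V := row_ebase L.
have LE : L = U *m pid_mx K *m V by rewrite -{1}(mulmx_ebase L) rL.
have Uu : U \in unitmx by exact: col_ebase_unit.
have Vu : V \in unitmx by exact: row_ebase_unit.
pose P' := invmx U *m P *m U; pose M' := V *m M *m invmx V.
have E : P' *m (pid_mx K : 'M[F]_(K + m, K)) = pid_mx K *m M'.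
  have UE : U *m pid_mx K = L *m invmx V by rewrite LE mulmxK.
  rewrite /P' -mulmxA UE -mulmxA [P *m _]mulmxA PL {1}LE /M' -!mulmxA.
  by rewrite mulKmx.
have cP : char_poly P = char_poly P'.
  apply: (@char_poly_intertwine _ _ _ (invmx U)); first by rewrite unitmx_inv.
  by rewrite /P' mulmxK.
have cM : char_poly M = char_poly M'.
  by apply: (@char_poly_intertwine _ _ _ V) => //; rewrite /M' mulmxKV.
have P'E : P' = block_mx M' (ursubmx P') 0 (drsubmx P').
  move: E; rewrite pid_mx_col -{1}[P']submxK mul_block_col mul_col_mx !mulmx1 !mulmx0 !addr0.
  by rewrite mul1mx mul0mx => /eq_col_mx[<- <-]; rewrite submxK.
rewrite cP cM P'E {2}/char_poly /char_poly_mx map_block_mx map_mx0 scalar_mx_block.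
rewrite opp_block_mx add_block_mx oppr0 addr0 det_ublock.
exact: dvdp_mulr.
Qed.

End CharPolyConj.

(** * Self-adjoint matrices are diagonalizable *)

Section SelfAdjoint.
Variables (R : realType) (n' : nat).
Let n := n'.+1.
Variables (w : 'I_n -> R) (P : 'M[R]_n).
Hypothesis w_gt0 : forall i, 0 < w i.
Hypothesis P_sym : forall i j, w i * P i j = w j * P j i.

Let W : 'M[R]_n := diag_mx (\row_i w i).

Lemma selfadjoint_horner (p : {poly R}) : W *m horner_mx P p = (horner_mx P p)^T *m W.
Proof.
elim/poly_ind: p => [|p a IH]; first by rewrite !rmorph0 trmx0 mulmx0 mul0mx.
have WP : W *m P = P^T *m W.
  by apply/matrixP => i j; rewrite mul_diag_mx mul_mx_diag !mxE [RHS]mulrC P_sym.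
have comm : horner_mx P p *m P = P *m horner_mx P p.
  have := congr1 (horner_mx P) (mulrC p 'X).
  by rewrite !rmorphM /= horner_mx_X.
rewrite rmorphD rmorphM /= horner_mx_X horner_mx_C mulmxDr linearD /= mulmxDl.
congr (_ + _); last by rewrite tr_scalar_mx scalar_mxC.
by rewrite [LHS]mulmxA IH -mulmxA WP mulmxA -trmx_mul -comm.
Qed.

(** For S = p(P) self-adjoint, S^T W S = W S^2 = 0, and W is positive definite. *)
Lemma selfadjoint_horner_sqr0 (p : {poly R}) :
  horner_mx P p *m horner_mx P p = 0 -> horner_mx P p = 0.
Proof.
set S := horner_mx P p => SS.
have : S^T *m W *m S = 0 by rewrite -selfadjoint_horner -mulmxA SS mulmx0.
move=> h; apply/matrixP => i j; rewrite mxE.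
have := congr1 (fun M : 'M[R]_n => M j j) h; rewrite !mxE.
under eq_bigr do rewrite mul_mx_diag !mxE -mulrA mulrCA -expr2.
move=> /eqP; rewrite psumr_eq0 => [/allP/(_ i)|k _]; last by rewrite mulr_ge0 ?sqr_ge0 // ltW.
rewrite mem_index_enum mulf_eq0 gt_eqF ?w_gt0 //= sqrf_eq0 => /(_ isT)/eqP.
by [].
Qed.

Lemma selfadjoint_horner_nilp (p : {poly R}) k :
  horner_mx P (p ^+ (2 ^ k)) = 0 -> horner_mx P p = 0.
Proof.
elim: k => [|k IH]; first by rewrite expr1.
rewrite expnSr exprM expr2 rmorphM /= => /selfadjoint_horner_sqr0; exact: IH.
Qed.

Lemma dvdp_prod_undup (s t : seq R) : {subset t <= s} ->
  \prod_(z <- t) ('X - z%:P) %| (\prod_(z <- undup s) ('X - z%:P)) ^+ size t.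
Proof.
elim: t => [|a t IH] ts; first by rewrite big_nil dvd1p.
rewrite big_cons exprS dvdp_mul //.
  rewrite dvdp_XsubCl root_prod_XsubC mem_undup ts // mem_head //.
by apply: IH => x xt; rewrite ts // in_cons xt orbT.
Qed.

(** Let p be the product of the X - z over the distinct eigenvalues z.  The
    characteristic polynomial divides a power of p, so p(P) is nilpotent, hence 0
    by self-adjointness; thus the minimal polynomial has simple roots. *)
Lemma selfadjoint_diagonalizable (s : seq R) :
  char_poly P = \prod_(z <- s) ('X - z%:P) ->
  exists2 Q : 'M[R]_n, Q \in unitmx & exists d : 'rV[R]_n, Q *m P = diag_mx d *m Q.
Proof.
move=> cP; set p := \prod_(z <- undup s) ('X - z%:P).
have pP0 : horner_mx P p = 0.
  apply: (@selfadjoint_horner_nilp _ (size s)).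
  have /dvdpP[r ->] : char_poly P %| p ^+ (2 ^ size s).
    rewrite cP; apply: (dvdp_trans (@dvdp_prod_undup s s _)) => //.
    by apply: dvdp_exp2l; rewrite ltnW // ltn_expl.
  by rewrite rmorphM /= Cayley_Hamilton mulr0.
have /diagonalizableP : exists2 rs, uniq rs & mxminpoly P %| \prod_(x <- rs) ('X - x%:P).
  by exists (undup s); rewrite ?undup_uniq // mxminpoly_min.
by case=> Q Qu /diagonalizable_forPex[d /(simmxP Qu) QP]; exists Q => //; exists d.
Qed.

End SelfAdjoint.

(** * Self-adjoint matrices have real eigenvalues *)

Section RealSpectrum.
Variables (R : realType) (n : nat).
Variables (w : 'I_n -> R) (P : 'M[R]_n).
Hypothesis w_gt0 : forall i, 0 < w i.
Hypothesis P_sym : forall i j, w i * P i j = w j * P j i.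

(** Here a + i b is a left eigenvector for x + i y.  Pairing with the weights
    1 / w, for which P is symmetric, the products of a with b P and of b with a P
    agree; but their difference is y (|a|^2 + |b|^2). *)
Lemma selfadjoint_no_rotation (a b : 'I_n -> R) (x y : R) :
  (forall j, \sum_k a k * P k j = x * a j - y * b j) ->
  (forall j, \sum_k b k * P k j = x * b j + y * a j) ->
  (exists k, (a k != 0) || (b k != 0)) -> y = 0.
Proof.
move=> ha hb [k0 ab0].
have PV i j : P i j / w j = P j i / w i.
  have wi := w_gt0 i; have wj := w_gt0 j.
  have -> : P i j = w j * P j i / w i by rewrite -P_sym; field; rewrite gt_eqF.
  by field; rewrite !gt_eqF.
have E : \sum_j b j / w j * (\sum_k a k * P k j) = \sum_j a j / w j * (\sum_k b k * P k j).
  under eq_bigr do rewrite mulr_sumr; under [RHS]eq_bigr do rewrite mulr_sumr.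
  rewrite exchange_big; apply: eq_bigr => k _; apply: eq_bigr => j _ /=.
  transitivity (b j * a k * (P k j / w j)); first by ring.
  by rewrite PV; ring.
have {E} : y * \sum_j (a j ^+ 2 + b j ^+ 2) / w j = 0.
  transitivity (\sum_j a j / w j * (\sum_k b k * P k j)
     - \sum_j b j / w j * (\sum_k a k * P k j)); last by rewrite E subrr.
  rewrite -sumrB mulr_sumr; apply: eq_bigr => j _; rewrite ha hb; ring.
move/eqP; rewrite mulf_eq0 => /orP[/eqP //|].
have pos j : 0 <= (a j ^+ 2 + b j ^+ 2) / w j.
  by rewrite divr_ge0 ?addr_ge0 ?sqr_ge0 // ltW.
rewrite psumr_eq0 => [/allP/(_ k0)|j _]; last exact: pos.
rewrite mem_index_enum mulf_eq0 invr_eq0 (gt_eqF (w_gt0 k0)) orbF => /(_ isT).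
rewrite /= paddr_eq0 ?sqr_ge0 // !sqrf_eq0 => /andP[a0 b0].
by rewrite a0 b0 in ab0.
Qed.

Lemma selfadjoint_char_poly_split :
  exists s : seq R, char_poly P = \prod_(z <- s) ('X - z%:P).
Proof.
pose f := real_complex R.
have [r rE] := closed_field_poly_normal (map_poly f (char_poly P)).
rewrite (monicP _) ?map_monic ?char_poly_monic // scale1r in rE.
have real z : z \in r -> z = f (complex.Re z).
  move=> zr; have : root (map_poly f (char_poly P)) z by rewrite rE root_prod_XsubC.
  rewrite map_char_poly -eigenvalue_root_char => /eigenvalueP[v vP v0].
  case: z zr vP => x y _ vP /=.
  suff -> : y = 0 by [].
  have ReD : {morph @complex.Re R : s t / s + t} by case=> [? ?] [? ?].
  have ImD : {morph @complex.Im R : s t / s + t} by case=> [? ?] [? ?].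
  apply: (@selfadjoint_no_rotation (fun k => complex.Re (v 0 k))
    (fun k => complex.Im (v 0 k)) x y).
  - move=> j; have := congr1 (fun M : 'rV_n => complex.Re (M 0 j)) vP.
    rewrite !mxE (big_morph _ ReD (erefl _)) /= => h.
    transitivity (complex.Re ((x +i* y)%C * v 0 j)); last by case: (v 0 j).
    rewrite -h; apply: eq_bigr => k _; rewrite mxE.
    by case: (v 0 k) => ? ? /=; rewrite mulr0 subr0.
  - move=> j; have := congr1 (fun M : 'rV_n => complex.Im (M 0 j)) vP.
    rewrite !mxE (big_morph _ ImD (erefl _)) /= => h.
    transitivity (complex.Im ((x +i* y)%C * v 0 j)); last by case: (v 0 j).
    rewrite -h; apply: eq_bigr => k _; rewrite mxE.
    by case: (v 0 k) => ? ? /=; rewrite mulr0 add0r.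
  - have /rV0Pn[k vk] := v0; exists k; apply: contraNT vk.
    rewrite negb_or !negbK => /andP[/eqP h1 /eqP h2].
    by case: (v 0 k) h1 h2 => ? ? /= -> ->.
exists (map (@complex.Re R) r); apply: (@map_poly_inj _ _ f).
rewrite rE map_prod_XsubC big_map big_seq [RHS]big_seq.
by apply: eq_bigr => z zr; rewrite {1}(real z zr).
Qed.

End RealSpectrum.

(** * Leading eigenvectors *)

Section LeadingEigenvectors.
Variables (R : realType).
Implicit Types (s t lam : seq R).

Definition abs_ge : rel R := fun a b => `|b| <= `|a|.

Lemma abs_ge_total : total abs_ge.
Proof. by move=> a b; rewrite /abs_ge le_total. Qed.

Lemma abs_ge_trans : transitive abs_ge.
Proof. by move=> b a d /[swap]; exact: le_trans. Qed.

(** Up to order, lam is a sublist of s, so s has at least [size lam] entries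
    of absolute value at least that of the last entry of lam; in a sorted list
    these come first. *)
Lemma eigenvalue_list_top n (A : 'M[R]_n) s lam j :
  eigenvalue_list A s -> sorted abs_ge lam ->
  \prod_(z <- lam) ('X - z%:P) %| char_poly A ->
  (size lam <= size s)%N -> (j < size lam)%N ->
  `|lam`_(size lam).-1| <= `|s`_j|.
Proof.
move=> [-> ss] sl /(dvdp_prod_XsubC (F := id))[m dm] lams jl.
have lam_mask : perm_eq lam (mask m s).
  by apply: prod_XsubC_eq; apply/eqP; rewrite -eqp_monic ?monic_prod_XsubC.
rewrite leNgt; apply/negP => sj.
pose c : pred R := fun z => `|lam`_(size lam).-1| <= `|z|.
have cl : count c lam = size lam.
  apply/eqP; rewrite -all_count; apply/(all_nthP 0) => i il.
  apply: (sorted_leq_nth abs_ge_trans (fun x => lexx _)) => //.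
  - by rewrite inE prednK // (leq_trans _ il).
  - by rewrite -ltnS prednK // (leq_trans _ il).
have : (size lam <= count c s)%N.
  rewrite -cl (seq.permP lam_mask c); exact: leq_count_mask.
rewrite -[s](cat_take_drop j) count_cat.
have -> : count c (drop j s) = 0%N.
  apply/eqP; rewrite -leqn0 leqNgt -has_count; apply/negP => /(has_nthP 0)[k].
  rewrite size_drop nth_drop => kj; rewrite /c leNgt => /negP; apply.
  apply: le_lt_trans sj.
  apply: (sorted_leq_nth abs_ge_trans (fun x => lexx _)) => //.
  - by rewrite inE (leq_trans jl).
  - by rewrite inE -ltn_subRL.
  - by rewrite leq_addr.
rewrite addn0 leqNgt => /negP; apply.
apply: leq_ltn_trans (count_size _ _) _.
by rewrite size_take; case: (ltnP j (size s)) => // h; exact: leq_ltn_trans h jl.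
Qed.

Lemma selfadjoint_leading_eigenvectors n K (w : 'I_n -> R) (P : 'M[R]_n) :
  (forall i, 0 < w i) -> (forall i j, w i * P i j = w j * P j i) ->
  (0 < n)%N -> (K <= n)%N -> exists X : 'M[R]_(n, K), leading_eigenvectors P X.
Proof.
case: n w P => // n' w P w0 Pw _ Kn.
have [s0 cP] := selfadjoint_char_poly_split w0 Pw.
have [Q Qu [d QP]] := selfadjoint_diagonalizable w0 Pw cP.
pose t0 := [tuple d 0 i | i < n'.+1].
pose s := sort abs_ge t0.
have st : perm_eq s t0 by rewrite perm_sort.
have [sg sE] := tuple_permP st.
have size_s : size s = n'.+1 by rewrite size_sort size_tuple.
have sn (j : 'I_n'.+1) : s`_j = d 0 (sg j).
  by rewrite sE -tnth_nth !tnth_mktuple.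
have PQ : P *m invmx Q = invmx Q *m diag_mx d.
  by apply: (can_inj (mulKmx Qu)); rewrite mulmxA QP mulmxK // mulKVmx.
pose wd : 'I_K -> 'I_n'.+1 := fun j => sg (widen_ord Kn j).
have wd_inj : injective wd by move=> i j /perm_inj/(congr1 val) ij; apply: val_inj.
exists (colsub wd (invmx Q)); exists s; split.
- split; last exact: (sort_sorted abs_ge_total).
  rewrite (char_poly_intertwine Qu QP) char_poly_trig ?diag_mx_is_trig //.
  rewrite (perm_big _ st) /= big_map big_enum /=.
  by apply: eq_bigr => i _; rewrite mxE eqxx mulr1n.
- by rewrite size_s.
- move=> j; rewrite col_colsub [in LHS]colE mulmxA PQ -colE; apply/matrixP => u v.
  rewrite (_ : s`_j = d 0 (wd j)); last exact: (sn (widen_ord Kn j)).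
  by rewrite mul_mx_diag !mxE mulrC.
- apply/row_freeP; exists (colsub wd Q^T).
  apply/matrixP => i j.
  have := congr1 (fun M : 'M[R]_n'.+1 => M (wd j) (wd i)) (mulmxV Qu).
  rewrite !mxE (inj_eq wd_inj) eq_sym => <-; apply: eq_bigr => k _.
  by rewrite !mxE mulrC.
Qed.

End LeadingEigenvectors.

(** * The Markov matrix of a graph with a spectral gap *)

Lemma char_poly_dvd_intertwine (F : fieldType) (K n : nat) (P : 'M[F]_n) (L : 'M[F]_(n, K))
    (M : 'M[F]_K) : (K <= n)%N -> \rank L = K -> P *m L = L *m M ->
  char_poly M %| char_poly P.
Proof.
move=> Kn; move: P L; rewrite -(subnKC Kn) => P L.
exact: char_poly_dvd_block.
Qed.

Lemma distinct_rows (F : fieldType) (m n : nat) (Y : 'M[F]_(m, n)) (a b : 'I_m) :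
  row_free Y -> row a Y = row b Y -> a = b.
Proof.
move=> Yf; rewrite !rowE => /(row_free_inj Yf) /matrixP/(_ 0 a).
by rewrite !mxE !eqxx /= eq_sym; case: eqP => // _ /eqP; rewrite oner_eq0.
Qed.

Section MarkovMatrix.
Variables (R : realType) (K : nat) (H : frame R K) (n : nat) (c : {ffun 'I_n -> 'I_K}).
Hypothesis cs : class_sizes H c.
Hypothesis n_pos : (0 < n)%N.
Hypothesis row_gt0 : forall i : 'I_K, (0 < \sum_j degree H i j)%N.
Variable G : 'M[bool]_n.
Hypothesis GO : G \in frame_graphs H c.

Notation P := (graph_markov R G).

Definition class_degree (i : 'I_K) : R := (\sum_j degree H i j)%N%:R.

Lemma class_degree_gt0 i : 0 < class_degree i.
Proof. by rewrite ltr0n. Qed.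

Lemma class_inhabited i : exists v, c v == i.
Proof.
have : 0 < #|[set v | c v == i]|%:R :> R.
  by rewrite cs mulr_gt0 ?ltr0n // weight_gt0.
by rewrite ltr0n => /card_gt0P[v]; rewrite finset.in_set => cv; exists v.
Qed.

Definition class_rep i : 'I_n := xchoose (class_inhabited i).

Lemma class_repE i : c (class_rep i) = i.
Proof. exact: eqP (xchooseP (class_inhabited i)). Qed.

Lemma classes_le : (K <= n)%N.
Proof.
have inj : injective class_rep by move=> i j /(congr1 c); rewrite !class_repE.
by have := leq_card _ inj; rewrite !card_ord.
Qed.

Lemma graph_degreeE u : #|[set v | G u v]|%:R = class_degree (c u).
Proof.
rewrite /class_degree natr_sum -(total_degreeE u GO) -sum1_card natr_sum big_mkcond.
by apply: eq_bigr => v _; rewrite finset.in_set; case: (G u v).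
Qed.

Lemma graph_markovE u v : class_degree (c u) * P u v = (G u v)%:R.
Proof.
have Du : degree_mx R G \in unitmx.
  rewrite unitmxE unitfE det_diag; apply/prodf_neq0 => i _; rewrite mxE graph_degreeE.
  by rewrite gt_eqF // class_degree_gt0.
have := congr1 (fun M : 'M[R]_n => M u v) (mulKVmx Du (adjacency R G)).
by rewrite mul_diag_mx !mxE graph_degreeE.
Qed.

Lemma graph_markov_sym u v : class_degree (c u) * P u v = class_degree (c v) * P v u.
Proof. by rewrite !graph_markovE (simple_graphC u v (frame_graph_simple GO)). Qed.

Definition class_mx : 'M[R]_(n, K) := \matrix_(v, i) (c v == i)%:R.

Lemma class_mx_rank : \rank class_mx = K.
Proof.
rewrite -mxrank_tr; apply/eqP; rewrite -/(row_free _); apply/row_freeP.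
exists (\matrix_(v, i) (v == class_rep i)%:R); apply/matrixP => i j; rewrite !mxE.
rewrite (bigD1 (class_rep j)) //= big1 ?addr0 => [|v /negbTE vj]; last by rewrite !mxE vj mulr0.
by rewrite !mxE eqxx mulr1 class_repE eq_sym.
Qed.

Lemma graph_markov_lift : P *m class_mx = class_mx *m frame_markov H.
Proof.
apply/matrixP => u j; apply: (mulfI (lt0r_neq0 (class_degree_gt0 (c u)))).
rewrite !mxE mulr_sumr [in RHS](bigD1 (c u)) //= [in RHS]big1 => [|i /negbTE ui]; last first.
  by rewrite !mxE eq_sym ui mul0r.
rewrite addr0 !mxE eqxx mul1r -/(class_degree (c u)) [RHS]mulrCA divff ?gt_eqF ?class_degree_gt0 //.
rewrite mulr1 -(frame_graph_degree u j GO); apply: eq_bigr => v _.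
by rewrite [class_mx v j]mxE mulrA graph_markovE mulrC.
Qed.

Lemma sum_class_function (y : 'I_n -> R) (h : 'I_K -> R) :
  (forall i, \sum_(v | c v == i) y v = 0) -> \sum_v h (c v) * y v = 0.
Proof.
move=> y0; rewrite (partition_big c xpredT) //= big1 // => i _.
rewrite (eq_bigr (fun v => h i * y v)) => [|v /eqP -> //].
by rewrite -mulr_sumr y0 mulr0.
Qed.

(** The deviation y of x from its class averages is orthogonal to the functions
    of the class, and both A and the degrees send such functions to functions of
    the class.  Pairing A x = z deg x with y thus gives
    z (sum of deg(u) y_u^2) = y^T A y = y^T (A - Q) y, and the gap forces y = 0. *)
Lemma eigenvector_class_function (x : 'cV[R]_n) (z l kappa : R) : 0 < l -> 0 < kappa ->
  (forall i, kappa <= class_degree i) ->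
  (forall y, `|bform (centered_adjacency H c G) y y| <= l * kappa / 2 * norm2 y) ->
  l <= `|z| -> P *m x = z *: x -> forall u v, c u = c v -> x u 0 = x v 0.
Proof.
move=> l0 k0 kd gap lz Px.
pose N i : R := n%:R * weight H i.
have N0 i : 0 < N i by rewrite mulr_gt0 ?ltr0n ?weight_gt0.
pose m i := (\sum_(v | c v == i) x v 0) / N i.
pose y v := x v 0 - m (c v).
have y0 i : \sum_(v | c v == i) y v = 0.
  have mi : \sum_(v | c v == i) m (c v) = \sum_(v | c v == i) m i.
    by apply: eq_bigr => v /eqP ->.
  rewrite sumrB mi sumr_const -mulr_natr.
  have -> : #|[pred v | c v == i]|%:R = N i :> R.
    by rewrite /N -cs; congr (_%:R); apply: eq_card => v; rewrite !inE.
  by rewrite /m divfK ?subrr // gt_eqF.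
have eig u : z * (class_degree (c u) * x u 0) = \sum_v (G u v)%:R * x v 0.
  have := congr1 (fun M : 'cV[R]_n => class_degree (c u) * M u 0) Px.
  rewrite !mxE mulr_sumr mulrCA => <-; apply: eq_bigr => v _.
  by rewrite mulrA graph_markovE.
have E : z * \sum_u class_degree (c u) * y u ^+ 2 =
    bform (centered_adjacency H c G) y y.
  transitivity (\sum_u y u * (z * (class_degree (c u) * x u 0))).
    have := sum_class_function (fun i => class_degree i * m i) y0 => h.
    transitivity (z * (\sum_u class_degree (c u) * y u ^+ 2
       + \sum_v class_degree (c v) * m (c v) * y v)); first by rewrite h addr0.
    rewrite -big_split mulr_sumr; apply: eq_bigr => u _ /=; rewrite /y; ring.
  under eq_bigr do rewrite eig mulr_sumr.
  have h1 : \sum_u \sum_v y u * ((G u v)%:R * m (c v)) = 0.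
    rewrite -[RHS](sum_class_function (fun i => \sum_j (degree H i j)%:R * m j) y0).
    apply: eq_bigr => u _; rewrite -mulr_sumr mulrC; congr (_ * _).
    under [RHS]eq_bigr do rewrite -(frame_graph_degree u _ GO) mulr_suml.
    rewrite exchange_big; apply: eq_bigr => v _ /=.
    rewrite (bigD1 (c v)) //= eqxx mul1r big1 ?addr0 // => j.
    by rewrite eq_sym => /negbTE ->; rewrite !mul0r.
  have h2 : \sum_u \sum_v edge_density H n (c u) (c v) * (y u * y v) = 0.
    rewrite big1 // => u _.
    rewrite -[RHS](sum_class_function (fun j => edge_density H n (c u) j * y u) y0).
    by apply: eq_bigr => v _; rewrite mulrA.
  transitivity (\sum_u \sum_v y u * ((G u v)%:R * x v 0)
    - \sum_u \sum_v y u * ((G u v)%:R * m (c v))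
    - \sum_u \sum_v edge_density H n (c u) (c v) * (y u * y v)).
    by rewrite h1 h2 !subr0.
  rewrite -!sumrB; apply: eq_bigr => u _; rewrite -!sumrB; apply: eq_bigr => v _.
  by rewrite /centered_adjacency /y; ring.
have dy : kappa * norm2 y <= \sum_u class_degree (c u) * y u ^+ 2.
  by rewrite mulr_sumr; apply: ler_sum => u _; rewrite ler_wpM2r ?sqr_ge0.
have ny : norm2 y = 0.
  apply/eqP; rewrite eq_le norm2_ge0 andbT leNgt; apply/negP => ny.
  have := gap y; rewrite -E normrM.
  have S0 : 0 <= \sum_u class_degree (c u) * y u ^+ 2.
    by apply: le_trans dy; rewrite mulr_ge0 // ltW.
  rewrite (ger0_norm S0) => h.
  have : l * (kappa * norm2 y) <= l * kappa / 2 * norm2 y.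
    apply: le_trans h; apply: ler_pM => //; first exact: ltW.
    by rewrite mulr_ge0 // ltW.
  rewrite mulrA [l * kappa / 2]mulrC -mulrA.
  have : 0 < l * kappa * norm2 y by rewrite !mulr_gt0.
  by lra.
have yv v : x v 0 = m (c v).
  have : y v ^+ 2 <= 0 by rewrite -ny norm2_coord.
  rewrite le_eqVlt ltNge sqr_ge0 orbF sqrf_eq0 => /eqP.
  by rewrite /y => /eqP; rewrite subr_eq0 => /eqP.
by move=> u v uv; rewrite !yv uv.
Qed.

(** The K leading eigenvalues of P are at least |lambda_K| in absolute value,
    since the characteristic polynomial of the frame divides that of P.  So the
    leading eigenvectors are functions of the class, X = L Y with L the matrix of
    the classes.  As the columns of X are independent, Y is invertible and its
    rows, which are the points of the clustering, are distinct. *)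
Lemma markov_recoverable (lam : K.-tuple R) (kappa : R) :
  eigenvalue_list (frame_markov H) lam -> 0 < `|lam`_K.-1| -> 0 < kappa ->
  (forall i, kappa <= class_degree i) ->
  (forall y, `|bform (centered_adjacency H c G) y y| <= `|lam`_K.-1| * kappa / 2 * norm2 y) ->
  spectrally_recoverable c P.
Proof.
move=> [lamE lam_sorted] l0 k0 kd gap; split.
  exact: (selfadjoint_leading_eigenvectors (fun u => class_degree_gt0 (c u)) graph_markov_sym
    n_pos classes_le).
move=> X [s [sE Ks Xs Xf]].
have dvd : \prod_(z <- lam) ('X - z%:P) %| char_poly P.
  by rewrite -lamE (char_poly_dvd_intertwine classes_le class_mx_rank graph_markov_lift).
have top (j : 'I_K) : `|lam`_K.-1| <= `|s`_j|.
  have := eigenvalue_list_top sE lam_sorted dvd (j := j).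
  by rewrite size_tuple => /(_ Ks (ltn_ord j)).
have cst (j : 'I_K) (u v : 'I_n) : c u = c v -> X u j = X v j.
  move=> uv; have := eigenvector_class_function l0 k0 kd gap (top j) (Xs j) uv.
  by rewrite !mxE.
split => // u v; split => [ruv|cuv]; last first.
  by apply/rowP => j; rewrite !mxE; exact: cst.
pose Y : 'M[R]_K := \matrix_(i, j) X (class_rep i) j.
have XY : X = class_mx *m Y.
  apply/matrixP => w j; rewrite !mxE (bigD1 (c w)) //= !mxE eqxx mul1r big1 ?addr0.
    by apply: cst; rewrite class_repE.
  by move=> i; rewrite !mxE eq_sym => /negbTE ->; rewrite mul0r.
have Yf : row_free Y.
  rewrite /row_free eqn_leq rank_leq_row /=.
  have := mxrankM_maxr class_mx Y; rewrite -XY.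
  by move: Xf; rewrite /row_free mxrank_tr => /eqP ->.
apply: (distinct_rows Yf); apply/rowP => j.
have := congr1 (fun r : 'rV[R]_K => r 0 j) ruv; rewrite !mxE => e.
by rewrite (cst j _ u) ?class_repE // (cst j (class_rep (c v)) v) ?class_repE.
Qed.

End MarkovMatrix.

(** * Recovery of the classes with high probability *)

Lemma frame_markov_scale (R : realType) (K : nat) (H : frame R K) (kappa : nat) :
  (0 < kappa)%N -> frame_markov (scale_frame H kappa) = frame_markov H.
Proof.
move=> k0; apply/matrixP => i j; rewrite !mxE.
have -> : (\sum_l degree (scale_frame H kappa) i l = kappa * \sum_l degree H i l)%N.
  by rewrite big_distrr; apply: eq_bigr => l _; rewrite mxE.
by rewrite !natrM -mulf_div divff ?mul1r // pnatr_eq0 -lt0n.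
Qed.

Lemma uniform_prob_ge (R : realType) (T : finType) (S Bad : {set T}) (E : T -> Prop) (e : R) :
  S != finset.set0 -> #|Bad|%:R <= #|S|%:R * e ->
  (forall x, x \in S -> x \notin Bad -> E x) ->
  `|1 - uniform_prob_in R S E| <= e.
Proof.
move=> S0 Be SE; rewrite /uniform_prob_in; set good := finset _.
have Sr : 0 < #|S|%:R :> R by rewrite ltr0n card_gt0.
have gS : #|good|%:R <= #|S|%:R :> R.
  by rewrite ler_nat subset_leq_card //; apply/fintype.subsetP => x; rewrite finset.in_set => /andP[].
have Sg : #|S|%:R <= #|good|%:R + #|Bad|%:R :> R.
  rewrite -natrD ler_nat; apply: leq_trans (leq_card_setU _ _).
  apply: subset_leq_card; apply/fintype.subsetP => x xS.
  rewrite finset.in_setU finset.in_set xS /=.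
  have [xB|xB] := boolP (x \in Bad); first by rewrite orbT.
  by rewrite orbF; apply/asboolP; exact: SE.
rewrite ger0_norm ?subr_ge0 ?ler_pdivrMr ?mul1r // lerBlDr -lerBlDl.
by rewrite ler_pdivlMr // mulrBl mul1r; lra.
Qed.

Local Open Scope classical_set_scope.

Theorem theorem19 (R : realType) (K : nat) (H : frame R K)
  (row_sum_gt0 : forall i : 'I_K, (0 < \sum_l degree H i l)%N)
  (lambda : K.-tuple R)
  (lambdaE : eigenvalue_list (frame_markov H) lambda)
  (lambdaK_gt0 : 0 < `|lambda`_K.-1|) :
  exists kappa : nat, (0 < kappa)%N /\
    forall c : forall n : nat, {ffun 'I_n -> 'I_K},
      (fun n : nat =>
         uniform_prob_in R (frame_graphs (scale_frame H kappa) (c n))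
           (fun G : 'M[bool]_n =>
              spectrally_recoverable (c n) (graph_markov R G)))
        @ within [set n : nat |
                    class_sizes (scale_frame H kappa) (c n) /\
                    frame_graphs (scale_frame H kappa) (c n) != finset.set0]
            \oo --> (1 : R).
Proof.
have [kappa [k0 [C [n1 gap]]]] := spectral_gap_whp row_sum_gt0 lambdaK_gt0.
exists kappa; split => // c.
set H' := scale_frame H kappa in gap *.
have degE i : (\sum_l degree H' i l = kappa * \sum_l degree H i l)%N.
  by rewrite big_distrr; apply: eq_bigr => l _; rewrite mxE.
have row' i : (0 < \sum_l degree H' i l)%N by rewrite degE muln_gt0 k0 row_sum_gt0.
apply/cvgrPdist_le => e e0; rewrite near_withinE; near=> n => -[cs Om0].
have n0 : (0 < n)%N by near: n; exact: nbhs_infty_ge.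
have n1n : (n1 <= n)%N by near: n; exact: nbhs_infty_ge.
have Ce : C / n%:R <= e.
  rewrite ler_pdivrMr ?ltr0n // mulrC -ler_pdivrMr //.
  by near: n; exact: nbhs_infty_ger.
have [Bad Bad_le good] := gap n (c n) n1n cs.
apply: (uniform_prob_ge (Bad := Bad) Om0).
  by apply: le_trans Bad_le _; rewrite ler_wpM2l.
move=> G GO GBad; apply: (markov_recoverable cs n0 row' GO (lam := lambda) (kappa := kappa%:R)).
- by rewrite frame_markov_scale.
- exact: lambdaK_gt0.
- by rewrite ltr0n.
- by move=> i; rewrite /class_degree ler_nat degE leq_pmulr // row_sum_gt0.
- exact: good GO GBad.
Unshelve. all: by end_near. Qed.
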